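(* Let $p$ be a prime, $q:=2^p$, and $G=\mathrm{PSL}(2,2^p)$. Let $x\in G$ be a non-identity element. Then $|x|=2$, or $|x|$ divides $q-1$, or $|x|$ divides $q+1$. Every maximal subgroup of $G$ is isomorphic to one of $C_2^p\rtimes C_{q-1}$, $D_{2(q-1)}$, $D_{2(q+1)}$, and $\mathrm{Sol}_G(x)$ is the union of the maximal subgroups of $G$ containing $x$. The numbers of maximal subgroups of $G$ of each type that contain $x$, the isomorphism types of their pairwise intersections, and $|\mathrm{Sol}_G(x)|$ are as follows. (1) If $|x|=2$: exactly $1$ subgroup isomorphic to $C_2^p\rtimes C_{q-1}$, exactly $q/2$ isomorphic to $D_{2(q-1)}$, exactly $q/2$ isomorphic to $D_{2(q+1)}$; the intersection of any two distinct maximal subgroups containing $x$ is isomorphic to $C_2$; and $|\mathrm{Sol}_G(x)|=3q(q-1)$. (2) If $|x|$ divides $q-1$: exactly $2$ isomorphic to $C_2^p\rtimes C_{q-1}$, exactly $1$ isomorphic to $D_{2(q-1)}$, and $0$ isomorphic to $D_{2(q+1)}$; the intersection of any two distinct maximal subgroups containing $x$ is isomorphic to $C_{q-1}$; and $|\mathrm{Sol}_G(x)|=2q(q-1)$. (3) If $|x|$ divides $q+1$: $0$ isomorphic to $C_2^p\rtimes C_{q-1}$, $0$ isomorphic to $D_{2(q-1)}$, exactly $1$ isomorphic to $D_{2(q+1)}$; and $|\mathrm{Sol}_G(x)|=2(q+1)$.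
   Context: For a finite group $G$ and $x\in G$, the solubilizer of $x$ is the set $\mathrm{Sol}_G(x)=\{y\in G\mid \langle x,y\rangle \text{ is soluble}\}$. $|x|$ is the order of $x$. $C_n$ is the cyclic group of order $n$, $C_2^p$ is the elementary abelian group of order $2^p$, and $D_{2n}$ is the dihedral group of order $2n$. The maximal subgroup denoted $C_2^p\rtimes C_{q-1}$ is the normalizer of a Sylow $2$-subgroup (Borel subgroup), of order $q(q-1)$. *)

(* Defs.v *)
From mathcomp Require Import all_boot all_order all_fingroup all_algebra all_solvable.

Set Implicit Arguments.
Unset Strict Implicit.
Unset Printing Implicit Defensive.

Import GRing.Theory GroupScope.

Section ProjectiveSpecialLinear.

Variables (n : nat) (F : finFieldType).

Definition SL : {set {'GL_n[F]}} := [set A : {'GL_n[F]} | (\det A == 1)%R].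

Lemma SL_group_set : group_set SL.
Proof.
apply/group_setP; split=> [|A B]; rewrite !inE; first by rewrite GL_1E det1.
by move=> /eqP detA /eqP detB; rewrite GL_ME det_mulmx detA detB mulr1.
Qed.

Canonical SL_group := Group SL_group_set.

Definition PSL : {set coset_of 'Z(SL)} := SL / 'Z(SL).

Canonical PSL_group := [group of PSL].

End ProjectiveSpecialLinear.

Section Solubilizer.

Variable gT : finGroupType.
Implicit Types (G M : {set gT}) (x : gT).

Definition solubilizer G x : {set gT} := [set y in G | solvable <<[set x; y]>>].

Definition maximals_over G x : {set {group gT}} :=
  [set M : {group gT} | maximal M G && (x \in M)].

(* In PSL(2, q) with q = 2 ^ p, this is being isomorphic to the Borel subgroup,
   written C_2^p : C_(q-1); the Sylow 2-subgroups being conjugate, the choice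
   of P is immaterial. *)
Definition isog_Borel G M : bool :=
  [exists P : {group gT}, (P \in 'Syl_2(G)) && (M \isog 'N_G(P))].

End Solubilizer.

(* Main.v *)
Require Import Defs.
From mathcomp Require Import all_boot all_order all_fingroup all_algebra all_solvable.
From mathcomp Require Import all_field ring zify.

Set Implicit Arguments.
Unset Strict Implicit.
Unset Printing Implicit Defensive.

Import GroupScope.

(** Every element of G = PSL(2, q), q = 2 ^ p, lies in a very small world of its
    own.  In even characteristic the centre of SL(2, q) is trivial, so G is
    SL(2, q) itself, and the centralizer C(x) of x != 1 is the group of elements
    of norm one in the algebra F[x] = {a + b x}: it is abelian, of order
    q + 1 - r, where r is the number of eigenvalues of x in F (card_cent_SL).
    So C(x) is elementary abelian of order q if x is an involution, and a cyclic
    torus of order q - 1 or q + 1 otherwise.  Commutation is then an equivalence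
    relation on G minus 1: the centralizers meet trivially and partition G.
    The record SL2_even keeps this much about matrices, together with two facts
    on fusion (the involutions are conjugate, the conjugates of x inside a torus
    C(x) are x and its inverse); the rest is group theory.

    Write N(x) for the normalizer of C(x).  It is a Borel subgroup, of order
    q (q - 1), when x is an involution, and dihedral of order 2 |C(x)| otherwise.
    The heart of the matter is that every proper subgroup H of G lies in some
    N(x) (proper_sub_norm).  This is the even case of Dickson's theorem, and the
    proof is his: the partition of G induces one of H, the conjugates of one
    part fill a proportion (a - 1) / n of H, where a is the order of the part
    and n that of its normalizer, and these proportions add up to 1 - 1 / |H|.
    If no N(x) contains H, the only solution in integers has
    |H| = s (s - 1) (s + 1), for a power s > 2 of 2 such that s - 1 divides
    q - 1 (dickson_order); as p is prime this forces s = q, hence H = G.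

    So the maximal subgroups of G are exactly the N(x), and they are soluble.
    A nontrivial soluble subgroup normalizes a nontrivial abelian one, hence some
    C(x); this identifies the solubilizer with a union of maximal subgroups
    (solubilizer_maximals).  Finding which N(w) contain x is easy if x belongs to
    a torus T: then w is in T or N(w) is a Borel subgroup, there are no such
    Borel subgroups if |T| = q + 1 and exactly two if |T| = q - 1
    (split_torus_two_borels), and any two of the maximal subgroups over x
    intersect in T.  An involution lies in one Borel subgroup and inverts q / 2
    tori of each kind, by double counting (card_maximals_over_invol); two
    maximal subgroups that contain it intersect in a group of order 2. *)

(** * Finite groups, double counting, divisibility *)

Lemma order2_sqr (gT : finGroupType) (x : gT) : #[x] = 2 -> x * x = 1.
Proof. by move=> ox; rewrite -(expg_order x) ox expgS expg1. Qed.

Lemma odd_group_sqr1 (gT : finGroupType) (A : {group gT}) (y : gT) :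
  odd #|A| -> y \in A -> y ^+ 2 = 1 -> y = 1.
Proof.
move=> oddA Ay /eqP; rewrite -order_dvdn => y2; apply/eqP; rewrite -order_eq1.
rewrite -dvdn1 -(eqnP (_ : coprime #[y] 2)) ?dvdn_gcd ?dvdnn //.
by rewrite coprimen2 (dvdn_odd (order_dvdG Ay)).
Qed.

Lemma cyclic_isog_Zp (gT : finGroupType) (A : {group gT}) : cyclic A -> A \isog Zp #|A|.
Proof. by case/cyclicP=> a ->; rewrite -orderE isog_sym Zp_isog. Qed.

Lemma double_count (S T : finType) (A : {set S}) (B : {set T}) (R : S -> T -> bool) :
  (\sum_(a in A) #|[set b in B | R a b]| = \sum_(b in B) #|[set a in A | R a b]|)%N.
Proof.
transitivity (\sum_(a in A) \sum_(b in B | R a b) 1)%N.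
  by apply: eq_bigr => a _; rewrite sum1dep_card; apply: eq_card => b; rewrite !inE.
rewrite (exchange_big_dep (mem B)) /=; last by move=> a b _ /andP[].
apply: eq_bigr => b Bb; rewrite sum1dep_card; apply: eq_card => a.
by rewrite !inE Bb.
Qed.

Lemma card_bigcup_disjoint (I T : finType) (D : {set I}) (F : I -> {set T}) :
  {in D &, forall i j, i != j -> [disjoint F i & F j]} ->
  #|\bigcup_(i in D) F i| = (\sum_(i in D) #|F i|)%N.
Proof.
move=> disF; pose F' i := if i \in D then F i else set0.
rewrite big_mkcond [RHS]big_mkcond -sum1_card.
rewrite (@partition_disjoint_bigcup _ _ _ _ _ F' (fun=> 1%N)) => [|i j neq_ij].
  by apply: eq_bigr => i _; rewrite sum1_card /F'; case: ifP => //; rewrite cards0.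
rewrite /F'; case: ifP => Di; last by rewrite -setI_eq0 set0I.
by case: ifP => Dj; [apply: disF | rewrite -setI_eq0 setI0].
Qed.

Lemma dvdn_sub1_add1 n : (n - 1 %| n + 1)%N -> (n <= 3)%N.
Proof.
case: n => [|n] //; rewrite subSS subn0 addn1 -addn2 addnC dvdn_addl ?dvdnn //.
by move/dvdn_leq=> /(_ isT).
Qed.

Section PredExp2.
Local Open Scope nat_scope.

(** Modulo 2 ^ m - 1 the number 2 ^ n is 2 ^ (n mod m), which is 1 only if m
    divides n. *)
Lemma dvdn_pred_exp2 m n : 1 < m -> (2 ^ m - 1 %| 2 ^ n - 1)%N -> (m %| n)%N.
Proof.
move=> m_gt1; set d := (2 ^ m - 1)%N.
have Dd : (d.+1 = 2 ^ m)%N by rewrite /d -addn1 subnK // expn_gt0.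
have exp1 : (2 ^ m = 1 %[mod d])%N by rewrite -Dd -addn1 modnDl.
have Dn : (2 ^ n = (2 ^ m) ^ (n %/ m) * 2 ^ (n %% m))%N.
  by rewrite -expnM -expnD mulnC -divn_eq.
rewrite -eqn_mod_dvd ?expn_gt0 // Dn -modnMml -modnXm exp1 modnXm exp1n modnMml mul1n.
have d_gt : 2 ^ (n %% m) < d.
  have : 2 ^ (n %% m) <= 2 ^ m.-1.
    by rewrite leq_exp2l // -ltnS prednK ?ltn_mod // ltnW.
  have : 2 ^ m = (2 * 2 ^ m.-1)%N by rewrite -expnS prednK // ltnW.
  have : 1 < 2 ^ m.-1 by rewrite -[X in X < _](expn0 2) ltn_exp2l // -ltnS prednK // ltnW.
  by rewrite /d; lia.
have d_gt1 : 1 < d by apply: leq_ltn_trans d_gt; rewrite expn_gt0.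
rewrite (modn_small d_gt) (modn_small d_gt1).
rewrite -[X in _ == X](expn0 2) eqn_exp2l // => /eqP m0; by apply/eqP.
Qed.

End PredExp2.

(** * The norm form of a quadratic algebra over a field of even order *)

Section NormForm.
Import GRing.Theory.
Local Open Scope ring_scope.

Variable F : finFieldType.
Hypothesis char2 : 2 \in [pchar F].

Lemma sqr_inj2 : injective (fun a : F => a ^+ 2).
Proof.
by move=> a b /eqP; rewrite eqf_sqr (oppr_pchar2 char2) orbb => /eqP.
Qed.

Lemma sqrt2 (a : F) : exists b : F, b ^+ 2 = a.
Proof.
by have [g _ gK] := injF_bij sqr_inj2; exists (g a); apply: (gK a).
Qed.

(** The norm of a + b x when x has trace t and determinant 1. *)
Definition norm_form (t : F) (ab : F * F) : F :=
  ab.1 ^+ 2 + t * ab.1 * ab.2 + ab.2 ^+ 2.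

(** The eigenvalues in F of a matrix of trace t and determinant 1; the sign of t
    does not matter in characteristic 2. *)
Definition roots_of_trace (t : F) : {set F} :=
  [set z : F | z ^+ 2 + t * z + 1 == 0].

(** A nonzero isotropic vector has a nonzero second coordinate b, and the ratio
    of its coordinates is a root of z ^ 2 + t z + 1: such a vector is a root
    together with b. *)
Lemma card_norm_form_eq0 (t : F) :
  #|[set ab | norm_form t ab == 0]|
    = (1 + #|roots_of_trace t| * #|F|.-1)%N.
Proof.
have -> : [set ab | norm_form t ab == 0] =
  (0, 0) |: [set (u.1 * u.2, u.2) | u in setX (roots_of_trace t) [set~ 0]].
  apply/setP=> [[a b]]; rewrite !inE /norm_form /=.
  apply/idP/idP=> [/eqP Q0 | /predU1P[[-> ->] | /imsetP[[z c]]]].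
  - have [b0 | nz_b] := eqVneq b 0.
      move: Q0; rewrite b0 mulr0 expr0n /= !addr0 => /eqP.
      by rewrite sqrf_eq0 => /eqP->; rewrite eqxx.
    apply/orP; right; apply/imsetP; exists (a / b, b); last by rewrite /= divfK.
    rewrite !inE nz_b andbT /=; apply/eqP/(mulfI (expf_neq0 2 nz_b)).
    by rewrite mulr0 -{}Q0; field.
  - by rewrite mulr0 expr0n /= !addr0.
  rewrite !inE /= => /andP[/eqP z_root _] [-> ->]; apply/eqP.
  by rewrite -[RHS](mulr0 (c ^+ 2)) -z_root; ring.
rewrite cardsU1 card_in_imset ?cardsX; last first.
  move=> [z c] [z' c']; rewrite !inE /= => /andP[_ nz_c] _ [eq_zc eq_c].
  by move: eq_zc; rewrite -eq_c => /(mulIf nz_c)->.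
rewrite cardsC1; congr (_ + _)%N.
case: imsetP => //= [[[z c]]]; rewrite !inE /= => /andP[_ nz_c] [_ c0].
by rewrite c0 eqxx in nz_c.
Qed.

(** The form is multiplied by c ^ 2 when a vector is scaled by c, and in even
    characteristic each value is a square in exactly one way, so an anisotropic
    vector is in a unique way a multiple of a vector of norm 1. *)
Lemma card_norm_form_neq0 (t : F) :
  #|[set ab | norm_form t ab != 0]|
    = (#|[set ab | norm_form t ab == 1%R]| * #|F|.-1)%N.
Proof.
rewrite -(cardsC1 (0 : F)) -cardsX.
rewrite -(@card_in_imset _ _ (fun u : F * F * F => (u.2 * u.1.1, u.2 * u.1.2))).
  congr #|pred_of_set _|; apply/setP=> [[a b]]; rewrite !inE.
  have scaleQ c u v : norm_form t (c * u, c * v) = c ^+ 2 * norm_form t (u, v).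
    by rewrite /norm_form /=; ring.
  apply/idP/imsetP=> [nzQ | [[[u v] c]]]; last first.
    rewrite !inE /= => /andP[/eqP Q1 nz_c] [-> ->].
    by rewrite scaleQ Q1 mulr1 expf_neq0.
  have [c Dc] := sqrt2 (norm_form t (a, b)).
  have nz_c : c != 0 by rewrite -sqrf_eq0 Dc.
  exists (c^-1 * a, c^-1 * b, c); last by rewrite /= !mulVKf.
  by rewrite !inE nz_c /= scaleQ -Dc exprVn mulVf ?expf_neq0 ?eqxx.
move=> [[u v] c] [[u' v'] c']; rewrite !inE /=.
move=> /andP[/eqP Q1 nz_c] /andP[/eqP Q1' _] [eq_u eq_v].
have eq_c : c = c'.
  apply: sqr_inj2; rewrite /= -[LHS]mulr1 -[RHS]mulr1 -{1}Q1 -Q1' /norm_form /=.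
  transitivity ((c * u) ^+ 2 + t * (c * u) * (c * v) + (c * v) ^+ 2); first by ring.
  by rewrite eq_u eq_v; ring.
by rewrite -eq_c in eq_u eq_v *; rewrite (mulfI nz_c eq_u) (mulfI nz_c eq_v).
Qed.

Lemma card_norm_form_eq1 (t : F) :
  (#|[set ab | norm_form t ab == 1%R]| + #|roots_of_trace t| = #|F| + 1)%N.
Proof.
have F_gt1 := finNzRing_gt1 F; have: (0 < #|F|.-1)%N by rewrite -ltnS prednK ?(ltnW F_gt1).
move=> F1_gt0; apply/eqP; rewrite -(eqn_pmul2r F1_gt0) mulnDl.
rewrite -card_norm_form_neq0 -(eqn_add2r 1) -addnA [(_ * _ + 1)%N]addnC.
rewrite -card_norm_form_eq0.
have -> : [set ab | norm_form t ab != 0] = ~: [set ab | norm_form t ab == 0].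
  by apply/setP=> ab; rewrite !inE.
rewrite addnC cardsC card_prod -{1 2 3}(prednK (ltnW F_gt1)).
by apply/eqP; ring.
Qed.

Lemma card_roots_of_trace0 : #|roots_of_trace 0| = 1%N.
Proof.
apply/eqP/cards1P; exists 1; apply/setP=> z; rewrite !inE mul0r addr0.
rewrite -[X in _ + X](expr1n _ 2) addr_eq0 (oppr_pchar2 char2).
by rewrite (inj_eq sqr_inj2).
Qed.

(** If z is a root then so is - t - z, which differs from z because 2 = 0. *)
Lemma card_roots_of_trace (t : F) : t != 0 ->
  #|roots_of_trace t| = 0%N \/ #|roots_of_trace t| = 2.
Proof.
move=> nz_t; have [-> | [z]] := set_0Vmem (roots_of_trace t).
  by rewrite cards0; left.
rewrite inE => /eqP z_root; right.
have -> : roots_of_trace t = [set z; - t - z].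
  apply/setP=> y; rewrite !inE -subr_eq0 -{1}z_root.
  have -> : y ^+ 2 + t * y + 1 - (z ^+ 2 + t * z + 1) = (y - z) * (y - (- t - z)).
    by ring.
  by rewrite mulf_eq0 !subr_eq0.
rewrite cards2 -subr_eq0 opprB opprK addrA [z + z](addrr_pchar2 char2) add0r.
by rewrite nz_t.
Qed.

End NormForm.

(** * Two by two matrices *)

Section Matrix2.
Import GRing.Theory.
Local Open Scope ring_scope.
Variable F : fieldType.
Implicit Types (x y u : 'M[F]_2) (a b : F).

Lemma ord2_cases (i : 'I_2) : i = 0 \/ i = 1.
Proof. by case: i => [[|[|//]] ?]; [left | right]; apply/val_inj. Qed.

Lemma mx2P x y : x 0 0 = y 0 0 -> x 0 1 = y 0 1 -> x 1 0 = y 1 0 ->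
  x 1 1 = y 1 1 -> x = y.
Proof.
move=> e00 e01 e10 e11; apply/matrixP=> i j.
by case: (ord2_cases i) => ->; case: (ord2_cases j) => ->.
Qed.

Lemma sum_ord2 (f : 'I_2 -> F) : \sum_i f i = f 0 + f 1.
Proof.
by rewrite !big_ord_recl big_ord0 addr0; congr (_ + f _); apply: val_inj.
Qed.

Lemma mul_mx2 x y i j : (x *m y) i j = x i 0 * y 0 j + x i 1 * y 1 j.
Proof. by rewrite mxE sum_ord2. Qed.

Lemma trace_mx2 x : \tr x = x 0 0 + x 1 1.
Proof. exact: sum_ord2. Qed.

Lemma det_mx2 x : \det x = x 0 0 * x 1 1 - x 0 1 * x 1 0.
Proof.
rewrite (expand_det_row _ 0) sum_ord2 /cofactor !det_mx11 !mxE /=.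
rewrite expr0 expr1 mul1r mulN1r mulrN.
by congr (_ * x _ _ - _ * x _ _); apply: val_inj.
Qed.

(** For non-scalar x these matrices are exactly those that commute with x, and
    they form a quadratic algebra over F. *)
Definition pencil x a b : 'M[F]_2 := a%:M + b *: x.

Lemma pencilE x a b : (pencil x a b 0 0 = a + b * x 0 0) *
  (pencil x a b 0 1 = b * x 0 1) * (pencil x a b 1 0 = b * x 1 0) *
  (pencil x a b 1 1 = a + b * x 1 1).
Proof. by rewrite !mxE /= !mulr1n !mulr0n !add0r. Qed.

Lemma det_pencil x a b :
  \det (pencil x a b) = a ^+ 2 + \tr x * a * b + \det x * b ^+ 2.
Proof. by rewrite !det_mx2 trace_mx2 !pencilE; ring. Qed.

Lemma trace_pencil x a b : \tr (pencil x a b) = a + a + b * \tr x.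
Proof. by rewrite !trace_mx2 !pencilE; ring. Qed.

Lemma mul_pencil x a b c d : pencil x a b *m pencil x c d =
  pencil x (a * c - b * d * \det x) (a * d + b * c + b * d * \tr x).
Proof.
by apply: mx2P; rewrite mul_mx2 !pencilE ?det_mx2 ?trace_mx2; ring.
Qed.

Lemma pencil01 x : pencil x 0 1 = x.
Proof. by rewrite /pencil raddf0 add0r scale1r. Qed.

Lemma comm_pencil x a b : pencil x a b *m x = x *m pencil x a b.
Proof. by rewrite mulmxDl mulmxDr scalar_mxC -scalemxAl -scalemxAr. Qed.

Lemma sqr_mx2 x : x *m x = \tr x *: x - (\det x)%:M.
Proof.
by apply: mx2P; rewrite mul_mx2 det_mx2 trace_mx2 !mxE /= ?mulr1n ?mulr0n; ring.
Qed.

Lemma pencil10 x : pencil x 1 0 = 1%:M.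
Proof. by rewrite /pencil scale0r addr0. Qed.

(** Deduces an equation from a multiple of another; the two sides are compared by
    a field identity. *)
Lemma lin_comb k a b (c d : F) : c = d -> a - b = k * (c - d) -> a = b.
Proof. by move=> -> /eqP; rewrite subrr mulr0 subr_eq0 => /eqP. Qed.

Lemma pencil_inj x a b c d : ~~ is_scalar_mx x ->
  pencil x a b = pencil x c d -> a = c /\ b = d.
Proof.
move=> nonscal_x eq_p.
have p00 : a + b * x 0 0 = c + d * x 0 0
  by have := congr1 (fun y : 'M_2 => y 0 0) eq_p; rewrite /= !pencilE.
have p01 : b * x 0 1 = d * x 0 1
  by have := congr1 (fun y : 'M_2 => y 0 1) eq_p; rewrite /= !pencilE.
have p10 : b * x 1 0 = d * x 1 0
  by have := congr1 (fun y : 'M_2 => y 1 0) eq_p; rewrite /= !pencilE.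
have p11 : a + b * x 1 1 = c + d * x 1 1
  by have := congr1 (fun y : 'M_2 => y 1 1) eq_p; rewrite /= !pencilE.
have eq_b : b = d.
  apply: contraNeq nonscal_x => neq_bd.
  have nz_bd: b - d != 0 by rewrite subr_eq0.
  apply/is_scalar_mxP; exists ((c - a) / (b - d)).
  apply: mx2P; rewrite !mxE /= ?mulr1n ?mulr0n.
  - by apply: (lin_comb (k := (b - d)^-1) p00); field.
  - by apply: (lin_comb (k := (b - d)^-1) p01); field.
  - by apply: (lin_comb (k := (b - d)^-1) p10); field.
  - by apply: (lin_comb (k := (b - d)^-1) p11); field.
by split=> //; move: p00; rewrite eq_b => /addIr.
Qed.

(** A non-scalar x has a nonzero entry off the diagonal or two distinct diagonal
    entries; dividing by it determines b, and a follows from the first entry. *)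
Lemma centralizer_pencil x y : ~~ is_scalar_mx x -> x *m y = y *m x ->
  exists a b, y = pencil x a b.
Proof.
move=> nonscal_x /matrixP comm_xy.
have := comm_xy 0 0; have := comm_xy 0 1; have := comm_xy 1 0.
rewrite !mul_mx2 => {comm_xy} e10 e01 e00.
have [z01 | nz01] := eqVneq (x 0 1) 0; last first.
  exists (y 0 0 - y 0 1 / x 0 1 * x 0 0), (y 0 1 / x 0 1).
  apply: mx2P; rewrite !pencilE; try by field.
  - by apply: (lin_comb (k := (x 0 1)^-1) e00); field.
  - by apply: (lin_comb (k := (x 0 1)^-1) e01); field.
have [z10 | nz10] := eqVneq (x 1 0) 0; last first.
  exists (y 0 0 - y 1 0 / x 1 0 * x 0 0), (y 1 0 / x 1 0).
  apply: mx2P; rewrite !pencilE; try by field.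
  - by apply: (lin_comb (k := - (x 1 0)^-1) e00); field.
  - by apply: (lin_comb (k := - (x 1 0)^-1) e10); field.
have [z11 | nz11] := eqVneq (x 0 0 - x 1 1) 0.
  case/is_scalar_mxP: nonscal_x; exists (x 1 1).
  by apply: mx2P; rewrite !mxE //=; apply/eqP; rewrite -subr_eq0; apply/eqP.
exists (y 0 0 - (y 0 0 - y 1 1) / (x 0 0 - x 1 1) * x 0 0),
  ((y 0 0 - y 1 1) / (x 0 0 - x 1 1)).
apply: mx2P; rewrite !pencilE; try by field.
- by apply: (lin_comb (k := (x 0 0 - x 1 1)^-1) e01); rewrite z01; field.
- by apply: (lin_comb (k := - (x 0 0 - x 1 1)^-1) e10); rewrite z10; field.
Qed.

(** The polarization of the identity of Cayley and Hamilton. *)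
Lemma mul_polarization x u : x *m u + u *m x =
  \tr u *: x + \tr x *: u + (\tr (x *m u) - \tr x * \tr u)%:M.
Proof.
by apply: mx2P; rewrite !trace_mx2 !mxE !sum_ord2 /=; ring.
Qed.

(** When u and x u have trace 0, polarization gives x u + u x = (tr x) u, so u
    conjugates x to tr x - x, which is the inverse of x if det x = 1.  The two
    trace conditions leave a plane of matrices U b c, and the determinant is nonzero
    at (0, 1), at (1, 0) or at (1, 1). *)
Lemma traceless_inverter x : ~~ is_scalar_mx x -> \tr x != 0 -> 2 \in [pchar F] ->
  exists u, [/\ \tr u = 0, \tr (x *m u) = 0 & \det u != 0].
Proof.
move=> nonscal_x nz_t char2; set t := \tr x.
pose U b c : 'M[F]_2 := \matrix_(i, j)
  if i == j then - (x 0 1 * c + x 1 0 * b) / t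
  else if i == 0 then b else c.
have twice (a : F) : a + a = 0 by rewrite (addrr_pchar2 char2).
have U_prop b c : [/\ \tr (U b c) = 0, \tr (x *m U b c) = 0
  & \det (U b c) = ((x 0 1 * c + x 1 0 * b) / t) ^+ 2 - b * c].
  split.
  - by rewrite trace_mx2 !mxE /= twice.
  - rewrite trace_mx2 !mul_mx2 !mxE /=.
    have -> : x 1 1 = t - x 0 0 by rewrite /t trace_mx2; ring.
    by field.
  - by rewrite det_mx2 !mxE /=; field.
have [z01 | nz01] := eqVneq (x 0 1) 0; last first.
  exists (U 0 1); have [-> -> ->] := U_prop 0 1; split=> //.
  have -> : ((x 0 1 * 1 + x 1 0 * 0) / t) ^+ 2 - 0 * 1 = (x 0 1 / t) ^+ 2 by ring.
  by rewrite expf_neq0 // mulf_neq0 ?invr_eq0.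
have [z10 | nz10] := eqVneq (x 1 0) 0; last first.
  exists (U 1 0); have [-> -> ->] := U_prop 1 0; split=> //.
  have -> : ((x 0 1 * 0 + x 1 0 * 1) / t) ^+ 2 - 1 * 0 = (x 1 0 / t) ^+ 2 by ring.
  by rewrite expf_neq0 // mulf_neq0 ?invr_eq0.
exists (U 1 1); have [-> -> ->] := U_prop 1 1; split=> //.
have -> : ((x 0 1 * 1 + x 1 0 * 1) / t) ^+ 2 - 1 * 1 = - 1.
  by rewrite z01 z10; ring.
by rewrite oppr_eq0 oner_eq0.
Qed.

End Matrix2.

(** * Centralizers in SL(2, F), F of even order *)

Section SpecialLinear2.
Import GRing.Theory.
Local Open Scope ring_scope.
Variable F : finFieldType.
Hypothesis char2 : 2 \in [pchar F].
Local Notation G := (SL_group 2 F).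
Local Notation mx g := (GLval g : 'M[F]_2).
Implicit Types g x y u : {'GL_2[F]}.

Lemma SL_det g : (g \in G) = (\det (mx g) == 1).
Proof. by rewrite inE. Qed.

Lemma SL_lift (A : 'M[F]_2) : \det A = 1 -> exists2 g, g \in G & mx g = A.
Proof.
move=> detA; have uA : A \is a GRing.unit by rewrite -/(_ \in unitmx) unitmxE detA unitr1.
by exists (FinRing.Unit uA); rewrite ?SL_det /= ?detA.
Qed.

Lemma GLvalM x y : mx (x * y)%g = mx x *m mx y. Proof. by []. Qed.
Lemma GLval1 : mx (1%g : {'GL_2[F]}) = 1%:M. Proof. by []. Qed.
Lemma GLval_inj : injective (fun g => mx g). Proof. exact: val_inj. Qed.

(** Each element of GL(2, F) is in a unique way a scalar times an element of
    SL(2, F), because its determinant has a unique square root. *)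
Lemma card_SL2 : #|G| = (#|F| * #|F|.-1 * #|F|.+1)%N.
Proof.
have F_gt1 := finNzRing_gt1 F.
have F1_gt0 : (0 < #|F|.-1)%N by rewrite -ltnS prednK ?(ltnW F_gt1).
apply/eqP; rewrite -(eqn_pmul2r F1_gt0).
have -> : (#|F| * #|F|.-1 * #|F|.+1 * #|F|.-1 = #|'GL_2[F]|)%N.
  by rewrite card_GL_2 expnS expn1; ring.
rewrite -[in X in _ == X](card_imset _ GLval_inj) -(cardsC1 (0 : F)) -cardsX.
rewrite -(@card_in_imset _ _ (fun u : {'GL_2[F]} * F => u.2 *: mx u.1)).
  apply/eqP; congr #|pred_of_set _|; apply/setP=> A; apply/imsetP/imsetP.
    case=> [[g c]]; rewrite !inE /= => /andP[/eqP det_g nz_c] ->.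
    have uA : (c *: mx g) \is a GRing.unit.
      by rewrite -/(_ \in unitmx) unitmxE detZ det_g mulr1 unitfE expf_neq0.
    by exists (FinRing.Unit uA); rewrite ?inE.
  case=> g _ ->; have nz_g : \det (mx g) != 0 := GL_det g; have [c Dc] := sqrt2 char2 (\det (mx g)).
  have nz_c : c != 0 by rewrite -sqrf_eq0 Dc.
  have [|h Gh Dh] := @SL_lift (c^-1 *: mx g).
    by rewrite detZ exprVn Dc mulVf .
  exists (h, c); last by rewrite /= Dh scalerA divff ?scale1r.
  by rewrite in_setX Gh !inE.
move=> [g c] [h d]; rewrite !inE /= => /andP[/eqP dg nz_c] /andP[/eqP dh _] eq_gh.
have eq_c : c = d.
  apply: (sqr_inj2 char2) => /=; have := congr1 (@determinant _ _) eq_gh.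
  by rewrite !detZ dg dh !mulr1.
rewrite eq_c in eq_gh *; congr (_, _); apply/GLval_inj.
by apply: (scalerI (a := d)); rewrite // -eq_c.
Qed.

Lemma SL_nonscalar x : x \in G -> x != 1%g -> ~~ is_scalar_mx (mx x).
Proof.
rewrite SL_det => /eqP det_x; apply: contraNN => /is_scalar_mxP[a Dx].
apply/eqP/GLval_inj; rewrite Dx GLval1; congr _%:M.
apply: (sqr_inj2 char2); rewrite /= expr1n -det_x Dx det_scalar.
by [].
Qed.

Section Centralizer.

Variable x : {'GL_2[F]}.
Hypotheses (Gx : x \in G) (ntx : x != 1%g).
Let t := \tr (mx x).
Let nsx := SL_nonscalar Gx ntx.

Lemma SL_det1 : \det (mx x) = 1. Proof. by apply/eqP; rewrite -SL_det. Qed.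

Lemma cent_SL_pencil y : y \in 'C_G[x] ->
  exists2 ab, norm_form t ab = 1 & mx y = pencil (mx x) ab.1 ab.2.
Proof.
case/setIP=> Gy /cent1P comm_xy.
have := congr1 (fun g => mx g) comm_xy; rewrite !GLvalM => /esym.
case/(centralizer_pencil nsx) => a [b Dy].
exists (a, b) => //; move: Gy.
by rewrite SL_det Dy det_pencil SL_det1 mul1r => /eqP.
Qed.

Lemma pencil_cent_SL ab : norm_form t ab = 1 ->
  exists2 y, y \in 'C_G[x] & mx y = pencil (mx x) ab.1 ab.2.
Proof.
case: ab => a b /= Q1; have [|y Gy Dy] := @SL_lift (pencil (mx x) a b).
  by rewrite det_pencil SL_det1 mul1r.
exists y => //; rewrite inE Gy; apply/cent1P/GLval_inj.
by rewrite !GLvalM Dy comm_pencil.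
Qed.

(** The centralizer is the set of elements of norm 1 in F[x]. *)
Lemma card_cent_SL : (#|'C_G[x]| + #|roots_of_trace t| = #|F| + 1)%N.
Proof.
rewrite -(card_norm_form_eq1 char2 t); congr (_ + _)%N.
rewrite -(card_imset _ GLval_inj).
rewrite -(@card_in_imset _ _ (fun ab => pencil (mx x) ab.1 ab.2)); last first.
  by move=> [a b] [c d] _ _ /(pencil_inj nsx)[/= -> ->].
congr #|pred_of_set _|; apply/setP=> A; apply/imsetP/imsetP=> [[y Cy ->] | [ab]].
  by have [ab Q1 Dy] := cent_SL_pencil Cy; exists ab; rewrite ?inE ?Q1.
rewrite inE => /eqP Q1 ->.
by have [y Cy Dy] := pencil_cent_SL Q1; exists y.
Qed.

Lemma cent_SL_unipotent : t = 0 -> 2.-abelem 'C_G[x] /\ #|'C_G[x]| = #|F|.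
Proof.
move=> t0; split; last first.
  by have := card_cent_SL; rewrite t0 card_roots_of_trace0 // => /addIn.
apply/abelemP=> //; split.
  apply/centsP=> y Cy z Cz; apply: GLval_inj; rewrite !GLvalM.
  have [ab _ ->] := cent_SL_pencil Cy; have [cd _ ->] := cent_SL_pencil Cz.
  by rewrite !mul_pencil; congr pencil; ring.
move=> y Cy; apply: GLval_inj; rewrite expgS expg1 GLvalM GLval1.
have [[a b] /= Q1 ->] := cent_SL_pencil Cy.
rewrite mul_pencil SL_det1 -/t t0 -(pencil10 (mx x)).
move: Q1; rewrite /norm_form t0 /= => Q1.
have twice (c : F) : c + c = 0 by rewrite (addrr_pchar2 char2).
congr pencil; last by rewrite mulr0 addr0 mulrC.
by rewrite mulr1 (oppr_pchar2 char2) -Q1; ring.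
Qed.

(** In a field L that contains an eigenvalue r of x, the map a + b x -> a + b r is
    multiplicative.  It is injective on elements of norm 1: their other
    eigenvalue is a + b (t - r), and the product of the two is 1, so both are 1
    if one is, and then b = 0 as r <> t - r. *)
Lemma cent_SL_cyclic : t != 0 -> cyclic 'C_G[x].
Proof.
move=> nz_t; pose p : {poly F} := 'X^2 + (- t) *: 'X + 1.
have sz_p : size p = 3.
  rewrite /p -addrA size_polyDl ?size_polyXn //.
  rewrite (leq_ltn_trans (size_polyD _ _)) // gtn_max size_scale ?oppr_eq0 //.
  by rewrite size_polyX size_poly1.
have nz_p : p != 0 by rewrite -size_poly_eq0 sz_p.
have [L [rs Dp _]] := FinSplittingFieldFor nz_p.
have [r rs_r] : exists r, r \in rs.
  case: rs Dp => [|r rs] Dp; last by exists r; rewrite mem_head.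
  by have := eqp_size Dp; rewrite big_nil size_poly1 size_map_poly sz_p.
pose io : {rmorphism F -> L} := in_alg L.
have r_root : r ^+ 2 - io t * r + 1 = 0.
  have : root (map_poly (in_alg L) p) r.
    by rewrite (eqp_root Dp) root_prod_XsubC.
  rewrite /root /p !rmorphD /= map_polyZ rmorph1 map_polyXn map_polyX !hornerE rmorphN mulNr.
  by move/eqP.
have twice (c : F) : c + c = 0 by rewrite (addrr_pchar2 char2).
(* In characteristic 2 the trace of a + b x is b t, so y determines b and then a. *)
pose b (y : {'GL_2[F]}) := \tr (mx y) / t; pose a y := mx y 0 0 - b y * mx x 0 0.
pose f y : L := io (a y) + io (b y) * r.
have fE y c d : mx y = pencil (mx x) c d -> f y = io c + io d * r.
  move=> Dy; have Db : b y = d.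
    by rewrite /b Dy trace_pencil twice add0r mulfK.
  by rewrite /f /a Db Dy pencilE addrK.
apply: (@field_mul_group_cyclic _ _ L f) => [y z Cy Cz | y Cy].
  have [[c d] /= _ Dy] := cent_SL_pencil Cy.
  have [[c' d'] /= _ Dz] := cent_SL_pencil Cz.
  rewrite (fE _ _ _ Dy) (fE _ _ _ Dz).
  have := GLvalM y z; rewrite Dy Dz mul_pencil SL_det1 mulr1 -/t => /fE->.
  have Dr : r * r = io t * r - 1.
    by apply/eqP; rewrite -subr_eq0 -[X in _ == X]r_root; apply/eqP; ring.
  have -> : (io c + io d * r) * (io c' + io d' * r) =
    io c * io c' + (io c * io d' + io d * io c') * r + io d * io d' * (r * r) :> L.
    by ring.
  rewrite Dr !(rmorphM, rmorphD, rmorphN).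
  by ring.
have [[c d] /= Q1 Dy] := cent_SL_pencil Cy; rewrite (fE _ _ _ Dy).
split=> [f1 | y1]; last first.
  have : pencil (mx x) c d = pencil (mx x) 1 0 by rewrite -Dy y1 pencil10.
  by case/(pencil_inj nsx) => -> ->; rewrite rmorph1 rmorph0 mul0r addr0.
have normL : (io c + io d * r) * (io c + io d * (io t - r)) = 1.
  transitivity (io (c ^+ 2 + t * c * d + d ^+ 2)); last by rewrite -(rmorph1 io) -Q1.
  rewrite !(rmorphM, rmorphD, rmorphXn).
  have -> : (io c + io d * r) * (io c + io d * (io t - r)) =
    io c ^+ 2 + io t * io c * io d + io d ^+ 2
      - io d ^+ 2 * (r ^+ 2 - io t * r + 1) by ring.
  by rewrite r_root mulr0 subr0.
have twiceL (z : L) : z + z = 0.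
  by rewrite -[z]mul1r -mulrDl -(rmorph1 io) -rmorphD twice rmorph0 mul0r.
have d0 : d = 0.
  move: normL; rewrite f1 mul1r -f1 => /addrI /eqP.
  rewrite -subr_eq0 -mulrBr -addrA -opprD twiceL subr0 -rmorphM fmorph_eq0.
  by rewrite mulf_eq0 (negPf nz_t) orbF => /eqP.
have c1 : c = 1.
  apply: (fmorph_inj io); rewrite rmorph1 -f1 d0 rmorph0 mul0r addr0.
  by [].
by apply: GLval_inj; rewrite Dy c1 d0 pencil10.
Qed.

Lemma card_cent_SL_torus : t != 0 ->
  #|'C_G[x]| = (#|F| - 1)%N \/ #|'C_G[x]| = (#|F| + 1)%N.
Proof.
move=> nz_t; have := card_cent_SL; have F_gt1 := finNzRing_gt1 F.
case: (card_roots_of_trace char2 nz_t) => ->; first by rewrite addn0; right.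
move=> oC; left; apply/eqP; rewrite -(eqn_add2r 2) {}oC.
by rewrite [(_ - 1 + _)%N]addnBAC ?(ltnW F_gt1) // addn2 addn1.
Qed.

(** A conjugate of x has the same trace t, so it is a + x if it commutes with x;
    as its determinant is 1, a is 0 or - t, and - t + x is the inverse of x
    up to a sign. *)
Lemma cent_SL_fusion g : t != 0 -> g \in G -> (x ^ g)%g \in 'C_G[x] ->
  (x ^ g)%g = x \/ (x ^ g)%g = x^-1%g.
Proof.
move=> nz_t Gg Cxg; have [[a b] Q1 Dxg] := cent_SL_pencil Cxg.
rewrite [(a, b).1]/= [(a, b).2]/= in Dxg.
have tr_xg : \tr (mx (x ^ g)%g) = t.
  by rewrite conjgE GLvalM mxtrace_mulC -GLvalM mulgK.
have b1 : b = 1.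
  move: tr_xg; rewrite Dxg trace_pencil (addrr_pchar2 char2) add0r.
  by rewrite -[RHS]mul1r => /(mulIf nz_t).
move: Q1; rewrite /norm_form b1 /= expr1n mulr1 -[RHS]add0r => /addIr.
have -> : a ^+ 2 + t * a = a * (a + t) by ring.
move/eqP; rewrite mulf_eq0 addr_eq0 => /orP[] /eqP Da.
  by left; apply: GLval_inj; rewrite Dxg b1 Da pencil01.
right; apply: (mulgI x); rewrite mulgV; apply: GLval_inj.
rewrite GLvalM Dxg b1 Da GLval1 -[X in X *m _](pencil01 (mx x)) mul_pencil SL_det1.
rewrite -/t -(pencil10 (mx x)); congr pencil; last by ring.
by rewrite mul0r !mul1r sub0r (oppr_pchar2 char2).
Qed.

Lemma cent_SL_real : t != 0 -> exists2 u, u \in G & (x ^ u)%g = x^-1%g.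
Proof.
move=> nz_t; have [v [trv0 trxv0 nz_v]] := traceless_inverter nsx nz_t char2.
have [c Dc] := sqrt2 char2 (\det v).
have nz_c : c != 0 by rewrite -sqrf_eq0 Dc.
have [|u Gu Du] := @SL_lift (c^-1 *: v).
  by rewrite detZ exprVn Dc mulVf.
exists u => //.
suff xux : (x * u * x = u)%g.
  by rewrite conjgE -(mulgK x (x * u)%g) xux mulKg.
apply: GLval_inj; rewrite -[LHS]/(mx x *m mx u *m mx x).
have Dx2 : mx x *m mx x = t *: mx x - 1%:M.
  by rewrite sqr_mx2 SL_det1.
have Dxu : mx x *m mx u = t *: mx u - mx u *m mx x.
  apply/eqP; rewrite -subr_eq opprK mul_polarization Du -scalemxAr !mxtraceZ trv0 trxv0.
  by rewrite !mulr0 subr0 raddf0 addr0 scale0r add0r.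
rewrite Dxu mulmxBl -scalemxAl -mulmxA Dx2 mulmxBr mulmx1 -scalemxAr.
by rewrite opprB addrC subrK.
Qed.

End Centralizer.

(** By Cayley and Hamilton x ^ 2 = (tr x) x - 1, so x ^ 2 = 1 forces tr x = 0 as x
    is not scalar. *)
Lemma cent_SL_invol x : x \in G -> #[x] = 2 -> \tr (mx x) = 0.
Proof.
move=> Gx ox; have ntx : x != 1%g by apply/eqP=> x1; move: ox; rewrite x1 order1.
have x2 : mx x *m mx x = 1%:M.
  have xx1 := order2_sqr ox.
  by have := congr1 (fun g => mx g) xx1; rewrite GLvalM.
have : pencil (mx x) (-1) (\tr (mx x)) = pencil (mx x) 1 0.
  rewrite pencil10 -x2 sqr_mx2 (SL_det1 Gx) /pencil addrC.
  by congr (_ + _); rewrite -raddfN.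
by have nsx := SL_nonscalar Gx ntx; move=> /(pencil_inj nsx)[_ tr0].
Qed.

(** Such a matrix is determined by its two entries off the diagonal. *)
Lemma card_traceless_SL : (#|[set x in G | \tr (mx x) == 0%R]| <= #|F| ^ 2)%N.
Proof.
rewrite -mulnn -card_prod.
rewrite -(@card_in_imset _ _ (fun x => (mx x 0 1, mx x 1 0))) ?max_card //.
move=> x y; rewrite !inE !det_mx2 !trace_mx2.
move=> /andP[/eqP dx /eqP tx] /andP[/eqP dy /eqP ty] [e01 e10].
have diag (z : 'M[F]_2) : z 0 0 + z 1 1 = 0 -> z 1 1 = z 0 0.
  by move/eqP; rewrite addrC addr_eq0 (oppr_pchar2 char2) => /eqP.
have e00 : mx x 0 0 = mx y 0 0.
  apply: (sqr_inj2 char2) => /=; apply: (addIr (- (mx x 0 1 * mx x 1 0))).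
  rewrite !expr2; rewrite (diag _ tx) in dx; rewrite (diag _ ty) in dy.
  by rewrite dx e01 e10.
by apply/GLval_inj/mx2P; rewrite // (diag _ tx) (diag _ ty).
Qed.

(** The class of x has q ^ 2 - 1 elements since its centralizer has q; with 1
    it fills the set of elements of trace 0, which has at most q ^ 2. *)
Lemma SL_invol_conj x y : x \in G -> y \in G -> #[x] = 2 -> #[y] = 2 ->
  y \in x ^: G.
Proof.
move=> Gx Gy ox oy.
have ntx : x != 1%g by apply/eqP=> x1; move: ox; rewrite x1 order1.
have tr0 := cent_SL_invol Gx ox.
have [_ oC] := cent_SL_unipotent Gx ntx tr0.
have F_gt1 := finNzRing_gt1 F.
pose I := [set z in G | \tr (mx z) == 0].
have mem_I z : z \in G -> #[z] = 2 -> z \in I.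
  by move=> Gz oz; rewrite in_set Gz; apply/eqP/cent_SL_invol.
have sxI : x ^: G \subset I :\ 1%g.
  apply/subsetP=> _ /imsetP[g Gg ->].
  have Gxg := groupJ Gx Gg.
  rewrite in_setD1 -order_eq1 orderJ ox; apply: mem_I; rewrite ?orderJ //.
have I1 : 1%g \in I.
  by rewrite in_set group1; apply/eqP; rewrite GLval1 mxtrace1 (pcharf0 char2).
have /eqP -> : x ^: G == I :\ 1%g.
  rewrite eqEcard sxI -index_cent1 -divgS ?subsetIl // oC card_SL2 -mulnA mulKn ?(ltnW F_gt1) //.
  have := card_traceless_SL; rewrite -/I (cardsD1 1%g I) I1 -mulnn.
  case: #|F| F_gt1 => // q _; rewrite andTb add1n.
  by have -> : (q.+1 * q.+1 = (q * q.+2).+1)%N by lia.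
by rewrite in_setD1 -order_eq1 oy mem_I.
Qed.

(** The centralizer of an element other than 1 has at most q + 1 elements. *)
Lemma center_SL2_eq1 : 'Z(G) = 1%g.
Proof.
apply/trivgP/subsetP=> x /centerP[Gx cGx]; rewrite inE.
apply: contraT => ntx'; have ntx : x != 1%g := ntx'.
have sGC : G \subset 'C_G[x].
  by rewrite subsetI subxx sub_cent1; apply/centP => y Gy; rewrite /commute cGx.
have le_GC := subset_leq_card sGC.
have oC := card_cent_SL Gx ntx.
move: le_GC oC (finNzRing_gt1 F).
rewrite card_SL2; move: #|'C_G[x]| #|roots_of_trace _| #|F| => c r [|[|q]] //= le_c eq_c _.
suff: (q.+3 < q.+2 * q.+1 * q.+3)%N by lia.
by rewrite -[X in (X < _)%N]mul1n ltn_pmul2r //; lia.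
Qed.
End SpecialLinear2.

(** * Arithmetic of the class equation *)

(** In these lemmas h is the order of a group, and u, v, w are the numbers of
    nontrivial elements in unions of conjugates of some part of its partition;
    u * n = (a - 1) * h says that the part has order a and its normalizer order
    n, as in card_support below.  The parts are a Sylow 2-subgroup of order s,
    with normalizer of order s k, and tori of order k or t. *)

Section Arithmetic.
Local Open Scope nat_scope.

Lemma cross_share (h n a u : nat) : 0 < a -> (u * n = (a - 1) * h)%N ->
  (u * n + h = a * h)%N.
Proof. by move=> a_gt0 ->; rewrite mulnBl mul1n subnK // leq_pmull. Qed.

(** 1 / 2 + 1 / h = 1 / s + 1 / (2 t) has no solution with h >= 4 t: s = 2 would
    give h = 2 t, and s >= 4 makes the right-hand side too small. *)
Lemma dickson_arith_dihedral (h s t u v : nat) : (u * s = (s - 1) * h)%N ->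
  (v * (2 * t) = (t - 1) * h)%N -> (u + v = h.-1)%N -> ~~ odd s -> 0 < s ->
  2 < t -> (2 * (2 * t) <= h)%N -> False.
Proof.
move=> /cross_share Eu /cross_share Ev Euv ev_s s_gt0 t_gt2 le_h.
have {Eu} Eu := Eu s_gt0; have {Ev} Ev := Ev (ltnW (ltnW t_gt2)).
have Eh : h = (u + v + 1)%N by lia.
have key : (2 * t * h + s * h = s * t * h + 2 * s * t)%N.
  have : (2 * t * (u * s + h) + s * (v * (2 * t) + h) + 2 * s * t
    = 2 * t * (s * h) + s * (t * h) + 2 * s * t)%N by rewrite Eu Ev.
  have -> : (2 * t * (u * s + h) + s * (v * (2 * t) + h) + 2 * s * t
    = 2 * s * t * (u + v + 1) + 2 * t * h + s * h)%N by ring.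
  by rewrite -Eh; lia.
have [s2 | s_gt2] := leqP s 2.
  have Es : s = 2 by lia. 
  by rewrite Es in key; lia.
have le1 : s <= (s - 2) * t.
  have : (s - 2) * 3 <= (s - 2) * t by rewrite leq_mul2l t_gt2 orbT.
  by lia.
have le2 : s * h <= (s - 2) * t * h by rewrite leq_mul2r le1 orbT.
have E3 : (s * t * h = (s - 2) * t * h + 2 * t * h)%N.
  by rewrite -!mulnDl subnK // ltnW.
have : 0 < s * t by rewrite muln_gt0 s_gt0; lia.
rewrite -mulnA in key; lia.
Qed.

(** The two shares add up to 1 - 1 / (s k).  So there is no room for another
    third of the group, and the total 1 - 1 / h is impossible for h >= 2 s k. *)
Lemma dickson_arith_frobenius (h s k u v : nat) :
  (u * (s * k) = (s - 1) * h)%N -> (v * k = (k - 1) * h)%N ->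
  3 < s * k -> 0 < s -> 0 < k -> (2 * (s * k) <= h)%N ->
  (u + v <> h.-1)%N /\ forall w, (h <= 3 * w)%N -> (u + v + w <= h.-1)%N -> False.
Proof.
move=> Eu Ev sk_gt3 s_gt0 k_gt0 le_h.
have {Eu} Eu := cross_share s_gt0 Eu; have {Ev} Ev := cross_share k_gt0 Ev.
have key : (s * k * (u + v) + h = s * k * h)%N.
  apply/eqP; rewrite -(eqn_add2r (s * h)).
  have -> : (s * k * (u + v) + h + s * h = (u * (s * k) + h) + s * (v * k + h))%N by ring.
  by rewrite Eu Ev; apply/eqP; ring.
split=> [Euv | w le_w le_uvw].
  have Eh : h = (u + v + 1)%N by lia.
  have : (s * k * (u + v) + h = s * k * (u + v) + s * k)%N.
    by rewrite key {1}Eh; ring.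
  by lia.
have [d Dd] : exists d, h = (u + v + d.+1)%N by exists (h - (u + v)).-1; lia.
have : h = (s * k * d.+1)%N.
  by apply: (@addnI (s * k * (u + v))); rewrite key {1}Dd; ring.
have : 4 * d.+1 <= s * k * d.+1 by rewrite leq_mul2r sk_gt3 orbT.
lia.
Qed.

(** The two shares add up to 1 / 2 + 1 / (2 k) - 1 / (s k). *)
Lemma dickson_arith_remainder (h s k u v : nat) :
  (u * (s * k) = (s - 1) * h)%N -> (v * (2 * k) = (k - 1) * h)%N ->
  0 < s -> 0 < k -> forall d, h = (u + v + d)%N ->
  (2 * (s * k) * d + s * h = s * k * h + 2 * h)%N.
Proof.
move=> Eu Ev s_gt0 k_gt0 d Eh.
have {Eu} Eu := cross_share s_gt0 Eu; have {Ev} Ev := cross_share k_gt0 Ev.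
have : (2 * (u * (s * k) + h) + s * (v * (2 * k) + h) + 2 * (s * k) * d
  = 2 * (s * h) + s * (k * h) + 2 * (s * k) * d)%N by rewrite Eu Ev.
have -> : (2 * (u * (s * k) + h) + s * (v * (2 * k) + h) + 2 * (s * k) * d
  = 2 * (s * k) * (u + v + d) + 2 * h + s * h)%N by ring.
by rewrite -Eh; lia.
Qed.

(** The two shares add up to at least 1 / 2 and less than 2 / 3, so they are not
    everything and leave no room for another two thirds. *)
Lemma dickson_arith_half (h s k u v : nat) :
  (u * (s * k) = (s - 1) * h)%N -> (v * (2 * k) = (k - 1) * h)%N ->
  3 < s -> 2 < k -> (2 * (s * k) <= h)%N ->
  (u + v <> h.-1)%N
  /\ forall w, (2 * h <= 3 * w)%N -> (u + v + w <= h.-1)%N -> False.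
Proof.
move=> Eu Ev s_gt3 k_gt2 le_h.
have sk_gt : 3 * s <= s * k by rewrite mulnC leq_mul2l k_gt2 orbT.
have key := dickson_arith_remainder Eu Ev (ltnW (ltnW (ltnW s_gt3))) (ltnW (ltnW k_gt2)).
split=> [Euv | w le_w le_uvw].
  have := key 1%N; have -> : h = (u + v + 1)%N by lia.
  move=> /(_ erefl); have <- : h = (u + v + 1)%N by lia.
  have : 3 * s * h <= s * k * h by rewrite leq_mul2r sk_gt orbT.
  by lia.
have [d Dd] : exists d, h = (u + v + d.+1)%N by exists (h - (u + v)).-1; lia.
have := key _ Dd; have le1 : 2 * h <= 3 * d by lia.
have : s * k * (2 * h) <= s * k * (3 * d) by rewrite leq_mul2l le1 orbT.
have : 3 * s * h <= s * k * h by rewrite leq_mul2r sk_gt orbT.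
have : 4 * h <= s * h by rewrite leq_mul2r s_gt3 orbT.
lia.
Qed.

(** The class equation 1 - 1 / h = u / h + v / h + w / h becomes
    2 + s t j = s k j + 2 t j for h = s k t j.  Halving, j divides 1, so
    (s - 2) (t - k) = 2 (k - 1) <= 2 (s - 2); as t - k is even and positive it
    is 2. *)
Lemma dickson_arith_SL2 (h s k t u v w : nat) :
  (u * (s * k) = (s - 1) * h)%N -> (v * (2 * k) = (k - 1) * h)%N ->
  (w * (2 * t) = (t - 1) * h)%N -> (u + v + w = h.-1)%N -> 0 < h ->
  3 < s -> ~~ odd s -> 2 < k -> odd k -> odd t -> (k %| s - 1)%N ->
  (s * k * t %| h)%N -> [/\ k = s - 1, t = s + 1 & h = s * k * t]%N.
Proof.
move=> Eu Ev Ew Euvw h_gt0 s_gt3 ev_s k_gt2 odd_k odd_t k_dv /dvdnP[j Dh].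
have le_k : k <= s - 1 by rewrite dvdn_leq // subn_gt0 (ltn_trans _ s_gt3).
have s_gt0 : 0 < s := ltn_trans (isT : 0 < 3) s_gt3.
have k_gt0 : 0 < k := ltn_trans (isT : 0 < 2) k_gt2.
clear k_dv.
have t_gt0 : 0 < t by case: t odd_t {Ew Dh}.
have key : (2 * (s * k) * w.+1 + s * h = s * k * h + 2 * h)%N.
  by apply: (dickson_arith_remainder Eu Ev) => //; lia.
have {Ew} Ew := cross_share t_gt0 Ew.
have key2 : (2 * (s * k * t) + s * t * h = s * k * h + 2 * t * h)%N.
  have : (t * (2 * (s * k) * w.+1 + s * h) + s * k * h
    = t * (s * k * h + 2 * h) + s * k * h)%N by rewrite key.
  have -> : (t * (2 * (s * k) * w.+1 + s * h) + s * k * h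
    = s * k * (w * (2 * t) + h) + 2 * (s * k * t) + s * t * h)%N by rewrite -addn1; ring.
  by rewrite Ew; lia.
have skt_gt0 : 0 < s * k * t by rewrite !muln_gt0 s_gt0 k_gt0.
have Ej : (2 + s * t * j = s * k * j + 2 * t * j)%N.
  apply/eqP; rewrite -(eqn_pmul2l skt_gt0); apply/eqP.
  rewrite Dh in key2; lia.
have [s' Ds] : exists s', s = (2 * s')%N by exists s./2; lia.
have Ej2 : (1 + s' * t * j = s' * k * j + t * j)%N by rewrite Ds in Ej; lia.
have j1 : j = 1%N.
  have : j %| 1 + s' * t * j by rewrite Ej2 dvdn_addl dvdn_mull.
  by rewrite dvdn_addl ?dvdn_mull // dvdn1 => /eqP.
rewrite {}j1 !muln1 mul1n in Ej Dh *.
have [t_lek | k_ltt] := leqP t k.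
  have : (s - 2) * t <= (s - 2) * k by rewrite leq_mul2l t_lek orbT.
  by lia.
have [c Dc] : exists c, t = (k + c.+2)%N by exists (t - k - 2)%N; lia.
have Ec : ((s - 2) * c.+2 = 2 * (k - 1))%N.
  by move: Ej; rewrite Dc mulnBl !mulnDr; clear -k_gt0; lia.
have c0 : c = 0%N.
  case: c {Dc} Ec => // c; have : (s - 2) * 3 <= (s - 2) * c.+3 by rewrite leq_mul2l orbT.
  by lia.
rewrite c0 in Ec Dc; split=> //; lia.
Qed.

Lemma half_share (h s u : nat) : (u * s = (s - 1) * h)%N -> 1 < s -> (h <= 2 * u)%N.
Proof.
move=> Eu s_gt1; have {Eu} Eu := cross_share (ltnW s_gt1) Eu.
rewrite -(leq_pmul2l (ltnW s_gt1)).
have : 2 * h <= s * h by rewrite leq_mul2r s_gt1 orbT.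
lia.
Qed.

Lemma share_lt_all (h s u : nat) : (u * s = (s - 1) * h)%N -> u = h.-1 -> 0 < h ->
  0 < s -> ~ (2 * s <= h)%N.
Proof.
move=> Eu Dh h_gt0 s_gt0; suff -> : h = s by lia.
have {Eu} Eu := cross_share s_gt0 Eu.
have Eh : h = (u + 1)%N by lia.
by rewrite {2}Eh in Eu; lia.
Qed.

Lemma shares_lt1_2 (h a b : nat) : (h <= 2 * a)%N -> (2 * h <= 3 * b)%N ->
  0 < h -> ~ (a + b <= h.-1)%N.
Proof. by lia. Qed.

Lemma shares_lt1_3 (h a b c : nat) : (h <= 2 * a)%N -> (h <= 3 * b)%N ->
  (h <= 3 * c)%N -> 0 < h -> ~ (a + b + c <= h.-1)%N.
Proof. by lia. Qed.

Lemma norm_orders_lt_SL2 q : 2 < q ->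
  [/\ q * (q - 1) < q * (q - 1) * (q + 1), 2 * (q - 1) < q * (q - 1) * (q + 1)
    & 2 * (q + 1) < q * (q - 1) * (q + 1)]%N.
Proof.
case: q => [|[|[|q]]] // _; rewrite (_ : q.+3 - 1 = q.+2)%N; last by lia.
split; nia.
Qed.

(** Here u and v are the sizes of the sets of involutions and of the nontrivial
    elements of one class of tori of order q - 1: if there were two such classes
    they would leave exactly q + 1 elements of the group, 1 included. *)
Lemma SL2_torus_class_arith q u v : 2 < q ->
  (u * (q * (q - 1)) = (q - 1) * (q * (q - 1) * (q + 1)))%N ->
  (v * (2 * (q - 1)) = (q - 1 - 1) * (q * (q - 1) * (q + 1)))%N ->
  (u + 2 * v + q + 1 = q * (q - 1) * (q + 1))%N.
Proof.
case: q => [|[|[|q]]] // _; rewrite !subn1 addn1 [_.+3.-1]/= [_.+2.-1]/= => Eu Ev.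
have {}Eu : u = (q.+2 * q.+4)%N.
  apply/eqP; rewrite -(@eqn_pmul2r (q.+3 * q.+2)) // Eu.
  by apply/eqP; clear; lia.
have {}Ev : (2 * v = q.+1 * (q.+3 * q.+4))%N.
  apply/eqP; rewrite -(@eqn_pmul2r q.+2) //.
  by apply/eqP; clear -Ev; lia.
by rewrite Ev Eu; clear; lia.
Qed.

(** The involutions and two classes of tori of order q + 1 do not fit in a group
    of order q (q - 1) (q + 1). *)
Lemma SL2_nonsplit_class_arith q u v : 2 < q ->
  (u * (q * (q - 1)) = (q - 1) * (q * (q - 1) * (q + 1)))%N ->
  (v * (2 * (q + 1)) = (q + 1 - 1) * (q * (q - 1) * (q + 1)))%N ->
  ~ (u + v + v <= (q * (q - 1) * (q + 1)).-1)%N.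
Proof.
case: q => [|[|[|q]]] // _; rewrite addnK !subn1 addn1 [_.+3.-1]/= => Eu Ev.
have {}Eu : u = (q.+2 * q.+4)%N.
  apply/eqP; rewrite -(@eqn_pmul2r (q.+3 * q.+2)) // Eu.
  by apply/eqP; clear; lia.
have {}Ev : (2 * v = q.+3 * (q.+3 * q.+2))%N.
  apply/eqP; rewrite -(@eqn_pmul2r q.+4) //.
  by apply/eqP; clear -Ev; lia.
rewrite -addnA addnn -mul2n Ev Eu; clear; lia.
Qed.

Lemma mul4_lt_SL2_order q : 3 < q -> (4 * q < q * (q - 1) * (q + 1))%N.
Proof.
case: q => [|[|[|[|q]]]] // _; rewrite subn1 addn1 /= -mulnA mulnC.
by rewrite ltn_pmul2l // mulSn; lia.
Qed.

(** Adds up 2, one Borel subgroup and q / 2 dihedral groups of each kind, when two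
    elements are removed from each of them. *)
Lemma invol_solubilizer_arith q : 3 < q -> ~~ odd q ->
  (2 + ((q * (q - 1) - 2) * 1 + (2 * (q - 1) - 2) * (q %/ 2)
    + (2 * (q + 1) - 2) * (q %/ 2)) = 3 * q * (q - 1))%N.
Proof.
move=> q_gt3 q_even; have [r ->] : exists r, q = (2 * r.+2)%N.
  by exists (q./2 - 2)%N; lia.
rewrite mulKn //.
have -> : (2 * r.+2 - 1 = 2 * r + 3)%N by clear; lia.
have -> : (2 * r.+2 * (2 * r + 3) - 2 = 4 * (r * r) + 14 * r + 10)%N.
  have -> : (2 * r.+2 * (2 * r + 3) = (4 * (r * r) + 14 * r + 10) + 2)%N by clear; lia.
  by rewrite addnK.
have -> : (2 * (2 * r + 3) - 2 = 4 * r + 4)%N by clear; lia.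
have -> : (2 * (2 * r.+2 + 1) - 2 = 4 * r + 8)%N by clear; lia.
by clear; lia.
Qed.

End Arithmetic.

(** * Groups with the centralizers of SL(2, q), q even *)

(** The information on SL(2, q), q even, from which its maximal subgroups are
    found.  It speaks only of orders, conjugation and centralizers, so it is
    carried over by any isomorphism. *)
Record SL2_even (gT : finGroupType) (G : {group gT}) (q : nat) : Prop := SL2Even {
  card_SL2_even : #|G| = (q * (q - 1) * (q + 1))%N;
  conj_SL2_even : {in G &, forall u v, #[u] = 2 -> #[v] = 2 -> v \in u ^: G};
  cent_SL2_even : {in G^#, forall x,
    2.-abelem 'C_G[x] /\ #|'C_G[x]| = q
    \/ [/\ cyclic 'C_G[x], #|'C_G[x]| = (q - 1)%N \/ #|'C_G[x]| = (q + 1)%N,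
           exists2 u, u \in G & x ^ u = x^-1
         & {in G, forall g, x ^ g \in 'C_G[x] -> x ^ g = x \/ x ^ g = x^-1}]} }.

(** Below, C x is the part of G that contains x and N x its normalizer.  The two
    kinds of parts are told apart by the order of x: the elements of order 2 have
    elementary abelian centralizers, the others lie in tori.  A Borel subgroup is
    N x for x of order 2; a torus is split if it has order q - 1. *)

Section SL2Even.

Variables (gT : finGroupType) (G : {group gT}) (q : nat).
Hypotheses (SL2_G : SL2_even G q) (q_gt2 : 2 < q) (q_2 : 2.-nat q).

Implicit Types (x y z : gT) (H : {group gT}).

Local Notation C x := 'C_G[x].
Local Notation N x := 'N_G('C_G[x]).

Let q_even : ~~ odd q.
Proof.
have [m Dq] := p_natP q_2.
by rewrite Dq oddX orbF; move: q_gt2; rewrite Dq; case: m {Dq}.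
Qed.

Let q_gt3 : 3 < q. Proof. by move: q_gt2 q_even; case: q => [|[|[|[|]]]]. Qed.

Lemma cent1_abelian x : x \in G^# -> abelian (C x).
Proof.
case/(cent_SL2_even SL2_G) => [[/abelem_abelian //] | [cycC _ _ _]].
exact: cyclic_abelian.
Qed.

Lemma mem_cent1 x : x \in G^# -> x \in C x.
Proof. by case/setD1P=> _ Gx; rewrite inE Gx cent1id. Qed.

(** Centralizers are abelian, so commutation is transitive outside 1. *)
Lemma cent1_sub_eq x y : x \in G^# -> y \in (C x)^# -> C y = C x.
Proof.
move=> G1x /setD1P[nty Cxy]; have Gy : y \in G by case/setIP: Cxy.
have G1y : y \in G^# by rewrite !inE nty.
apply/eqP; rewrite eqEsubset !subsetI !subsetIl !sub_cent1 /=.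
rewrite (subsetP (cent1_abelian G1y)); last first.
  by rewrite inE (setD1P G1x).2 cent1C (setIP Cxy).2.
by rewrite (subsetP (cent1_abelian G1x)).
Qed.

Lemma subcent1J x g : g \in G -> C x :^ g = C (x ^ g).
Proof. by move=> Gg; rewrite conjIg cent1J conjGid. Qed.

(** The parts C x are TI-subsets: an element of G normalizes C x as soon as it
    moves one nontrivial element of C x inside C x. *)
Lemma conj_mem_cent1 x y g : x \in G^# -> y \in (C x)^# -> g \in G ->
  (y ^ g \in C x) = (g \in N x).
Proof.
move=> G1x C1y Gg; rewrite [g \in N x]inE Gg /=; apply/idP/normP=> [Cyg | nCg].
  have [nty Cy] := setD1P C1y; have Eyx := cent1_sub_eq G1x C1y.
  rewrite -{1}Eyx subcent1J //; apply: cent1_sub_eq => //.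
  by rewrite in_setD1 conjg_eq1 nty.
by rewrite -nCg memJ_conjg; case/setD1P: C1y.
Qed.

Lemma cent1_sub_norm x : C x \subset N x.
Proof. by rewrite subsetI subsetIl normG. Qed.

Lemma cent1_norm_id x : x \in G^# -> 'C_(N x)[x] = C x.
Proof.
move=> G1x; apply/eqP; rewrite eqEsubset setSI ?subsetIl //=.
by rewrite subsetI cent1_sub_norm subsetIr.
Qed.

Lemma odd_torus_order n : n = (q - 1)%N \/ n = (q + 1)%N -> odd n.
Proof. by lia. Qed.

Lemma cent1_invol x : x \in G^# -> (#[x] == 2) = (#|C x| == q).
Proof.
move=> G1x; have Cx := mem_cent1 G1x; have [ntx Gx] := setD1P G1x.
case: (cent_SL2_even SL2_G G1x) => [[abC ->] | [_ /odd_torus_order oddC _ _]].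
  by rewrite eqxx (abelem_order_p abC).
have := order_dvdG Cx; case: eqP => [-> | _ _].
  by rewrite dvdn2 oddC.
by apply/esym; apply: contraTF oddC => /eqP->.
Qed.

Lemma invol_cent1 x : x \in G -> #[x] = 2 -> 2.-abelem (C x) /\ #|C x| = q.
Proof.
move=> Gx ox; have G1x : x \in G^# by rewrite !inE -order_eq1 ox.
have /eqP oC : #|C x| == q by rewrite -cent1_invol ?ox.
case: (cent_SL2_even SL2_G G1x) => // -[_ /odd_torus_order].
by rewrite oC (negPf q_even).
Qed.

Lemma mem_invol_cent1 x y : x \in G -> #[x] = 2 -> y \in (C x)^# -> #[y] = 2.
Proof.
move=> Gx ox /setD1P[nty Cy]; have [abC _] := invol_cent1 Gx ox.
exact: abelem_order_p abC Cy nty.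
Qed.

(** N x permutes the conjugates of x in C x, which are x and its inverse, so C x
    has index 2 in N x.  An element v outside C x inverts C x; its square lies
    in C x, is fixed and inverted by v, and has odd order, so v is an
    involution. *)
Lemma torus_cent1 x : x \in G^# -> #[x] != 2 ->
  [/\ cyclic (C x), #|C x| = (q - 1)%N \/ #|C x| = (q + 1)%N, odd #|C x|,
     #|N x| = (2 * #|C x|)%N
   & {in N x :\: C x, forall v, #[v] = 2 /\ {in C x, forall y, y ^ v = y^-1}}].
Proof.
move=> G1x; rewrite cent1_invol // => not_unip.
have inC1 y : y \in (C x)^# ->
  {in N x :\: C x, forall v, y ^ v = y^-1}.
  move=> C1y v /setDP[/setIP[Gv nCv] not_Cv].
  have Eyx := cent1_sub_eq G1x C1y; have [nty Cy] := setD1P C1y.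
  have G1y : y \in G^# by rewrite !inE nty (setIP Cy).1.
  case: (cent_SL2_even SL2_G G1y) => [[_ oC] | [_ _ _ fusion]].
    by rewrite -Eyx oC eqxx in not_unip.
  have [||yv|//] := fusion v => //; first by rewrite Eyx memJ_norm.
  case/negP: not_Cv; rewrite -Eyx inE Gv cent1C.
  exact/cent1P/commgP/conjg_fixP.
have C1x : x \in (C x)^# by rewrite in_setD1 (setD1P G1x).1 mem_cent1.
case: (cent_SL2_even SL2_G G1x) => [[_ oC] | [cycC oC [u Gu xu] fusion]].
  by rewrite oC eqxx in not_unip.
have oddC := odd_torus_order oC.
have inv_neq y : y \in (C x)^# -> y^-1 != y.
  case/setD1P=> nty Cy; apply: contraNneq nty => yV; apply/eqP.
  by apply: (odd_group_sqr1 oddC Cy); rewrite expgS expg1 -{1}yV mulVg.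
have oN : #|N x| = (2 * #|C x|)%N.
  have Nu : u \in N x by rewrite -(conj_mem_cent1 G1x C1x Gu) xu groupV mem_cent1.
  have <- : #|x ^: N x| = 2.
    have -> : x ^: N x = [set x; x^-1].
      apply/setP=> y; rewrite in_set2; apply/imsetP/idP=> [[g Ng ->]|].
        have [Gg _] := setIP Ng; rewrite -(conj_mem_cent1 G1x C1x Gg) in Ng.
        by have [->|->] := fusion g Gg Ng; rewrite eqxx ?orbT.
      by case/pred2P=> ->; [exists 1; rewrite ?conjg1 | exists u].
    by rewrite cards2 eq_sym inv_neq.
  by rewrite -index_cent1 cent1_norm_id // mulnC Lagrange // cent1_sub_norm.
split=> // v NCv; have [Nv not_Cv] := setDP NCv.
have inv_v y : y \in C x -> y ^ v = y^-1.
  have [-> _ | nty Cy] := eqVneq y 1; first by rewrite conj1g invg1.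
  by apply: inC1 => //; rewrite in_setD1 nty.
split=> //; have Cv2 : v ^+ 2 \in C x.
  have nCN : C x <| N x by rewrite normal_subnorm subsetIl.
  have oNC : #|N x / C x| = 2.
    by rewrite card_quotient ?subsetIr // -divgS ?cent1_sub_norm // oN mulnK.
  apply: coset_idr; first by rewrite groupX // (subsetP (subsetIr _ _) v Nv).
  rewrite morphX ?(subsetP (subsetIr _ _) v Nv) //= -oNC expg_cardG //.
  by rewrite mem_quotient.
have v2 : v ^+ 2 = 1.
  apply: (odd_group_sqr1 oddC Cv2).
  have := inv_v _ Cv2; rewrite conjXg conjgE mulKg => /eqP.
  by rewrite eq_sym eq_invg_mul => /eqP e; rewrite expgS expg1.
apply: nt_prime_order => //; apply: contraNneq not_Cv => ->; exact: group1.
Qed.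

Lemma invol_conj x y : x \in G -> #[x] = 2 -> y \in G -> #[y] = 2 ->
  exists2 g, g \in G & y = x ^ g.
Proof.
move=> Gx ox Gy oy; have /imsetP[g Gg Dy] := conj_SL2_even SL2_G Gx Gy ox oy.
by exists g.
Qed.

(** N x is transitive on the q - 1 involutions of C x: two of them are conjugate
    in G, and the conjugating element normalizes C x. *)
Lemma card_norm_invol x : x \in G -> #[x] = 2 -> #|N x| = (q * (q - 1))%N.
Proof.
move=> Gx ox; have [abC oC] := invol_cent1 Gx ox.
have G1x : x \in G^# by rewrite !inE -order_eq1 ox.
have C1x : x \in (C x)^# by rewrite in_setD1 (setD1P G1x).1 mem_cent1.
have xN : x ^: N x = (C x)^#.
  apply/setP=> y; apply/imsetP/idP=> [[g Ng ->] | C1y].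
    have [Gg _] := setIP Ng.
    by rewrite in_setD1 conjg_eq1 (setD1P G1x).1 (conj_mem_cent1 G1x).
  have [_ Cy] := setD1P C1y; have [Gy _] := setIP Cy.
  have [g Gg Dy] := invol_conj Gx ox Gy (mem_invol_cent1 Gx ox C1y).
  by exists g; rewrite // -(conj_mem_cent1 G1x C1x Gg) -Dy.
have idx : #|N x : C x| = #|(C x)^#|.
  by rewrite -xN -index_cent1 cent1_norm_id.
rewrite -(Lagrange (cent1_sub_norm x)) idx oC.
by have := cardsD1 1 (C x); rewrite group1 oC => ->; rewrite addnC addnK.
Qed.

(** The partition of a subgroup H: the part of x is A x, its normalizer is NH x,
    and the conjugates of A x in H cover U x. *)

Section Subgroup.

Variable H : {group gT}.
Hypothesis sHG : H \subset G.

Local Notation A x := ('C_H[x]).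
Local Notation NH x := ('N_H('C_G[x])).
Local Notation U x := (class_support (A x)^# H).

Let sub1 x : x \in H^# -> x \in G^#.
Proof. by case/setD1P=> ntx Hx; rewrite in_setD1 ntx (subsetP sHG). Qed.

Let subA x : {subset (A x)^# <= (C x)^#}.
Proof.
by move=> y /setD1P[nty Ay]; rewrite in_setD1 nty (subsetP (setSI _ sHG)).
Qed.

Lemma centH_sub_norm x : A x \subset NH x.
Proof. by rewrite subsetI subsetIl (subset_trans (setSI _ sHG)) // normG. Qed.

Lemma mem_centH x : x \in H^# -> x \in (A x)^#.
Proof. by move=> H1x; rewrite in_setD1 inE cent1id; case/setD1P: H1x => -> ->. Qed.

Lemma support_sub x : U x \subset H^#.
Proof.
apply/subsetP=> _ /imset2P[a g /setD1P[nta /setIP[Ha _]] Hg ->].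
by rewrite in_setD1 conjg_eq1 nta groupJ.
Qed.

(** The conjugates of A x meet trivially. *)
Lemma card_support x : x \in H^# ->
  (#|U x| * #|NH x| = (#|A x| - 1) * #|H|)%N.
Proof.
move=> H1x; have G1x := sub1 H1x.
have TI : normedTI (A x)^# H (NH x).
  apply/normedTI_memJ_P; split; rewrite ?subsetIl //.
    by apply/set0Pn; exists x; apply: mem_centH.
  move=> a g A1a Hg; have Gg := subsetP sHG g Hg.
  have [nta Aa] := setD1P A1a; have [Ha _] := setIP Aa.
  rewrite in_setD1 conjg_eq1 nta /= inE groupJ //= [RHS]inE Hg /=.
  have := conj_mem_cent1 G1x (subA A1a) Gg.
  by rewrite [_ \in C x]inE groupJ ?(subsetP sHG) //= [_ \in N x]inE Gg.
rewrite (card_support_normedTI TI) -mulnA [(_ * #|NH x|)%N]mulnC Lagrange ?subsetIl //.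
by rewrite [in RHS](cardsD1 1) group1 addKn.
Qed.

Lemma support_cent1 x y : x \in H^# -> y \in H^# ->
  reflect (exists2 g, g \in H & C y = C x :^ g) (y \in U x).
Proof.
move=> H1x H1y; have [G1x G1y] := (sub1 H1x, sub1 H1y).
apply: (iffP imset2P) => [[a g A1a Hg ->] | [g Hg Cy]].
  exists g; rewrite // -subcent1J ?(subsetP sHG) //.
  by rewrite (cent1_sub_eq G1x (subA A1a)).
exists (y ^ g^-1) g; rewrite ?conjgKV // in_setD1 conjg_eq1 (setD1P H1y).1 /=.
have: y ^ g^-1 \in C x by rewrite -mem_conjg -Cy mem_cent1.
by rewrite !inE => /andP[_ ->]; rewrite groupJ ?groupV ?(setD1P H1y).2.
Qed.

Lemma support_disjoint x y : x \in H^# -> y \in H^# -> y \notin U x ->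
  [disjoint U x & U y].
Proof.
move=> H1x H1y; apply: contraR => /pred0Pn[w /andP[/= Uxw Uyw]].
have H1w := subsetP (support_sub x) w Uxw.
case/(support_cent1 H1x H1w): Uxw => g Hg Cwx.
case/(support_cent1 H1y H1w): Uyw => h Hh Cwy.
apply/(support_cent1 H1x H1y); exists (g * h^-1); first by rewrite groupM ?groupV.
by rewrite conjsgM -Cwx Cwy conjsgK.
Qed.

Lemma support_cover (S : {set gT}) : S \subset H^# ->
  #|S| = #|H|.-1 \/ exists2 y, y \in H^# & y \notin S.
Proof.
move=> sSH; have [eqS | neqS] := eqVneq S H^#.
  by left; rewrite eqS [#|H|](cardsD1 1) group1.
by right; apply/subsetPn; rewrite eqEsubset sSH in neqS.
Qed.

Lemma card_support2 x y : x \in H^# -> y \in H^# -> y \notin U x ->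
  #|U x :|: U y| = (#|U x| + #|U y|)%N.
Proof.
move=> H1x H1y Uy; apply/eqP; rewrite (leq_card_setU _ _).2.
exact: support_disjoint.
Qed.

Lemma card_support3 x y w : x \in H^# -> y \in H^# -> w \in H^# ->
  y \notin U x -> w \notin U x :|: U y ->
  #|U x :|: U y :|: U w| = (#|U x| + #|U y| + #|U w|)%N.
Proof.
move=> H1x H1y H1w Uy; rewrite inE negb_or => /andP[Uxw Uyw].
rewrite -card_support2 //; apply/eqP; rewrite (leq_card_setU _ _).2.
rewrite -setI_eq0 setIUl; have := support_disjoint H1x H1w Uxw.
by have := support_disjoint H1y H1w Uyw; rewrite -!setI_eq0 => /eqP-> /eqP->; rewrite setU0.
Qed.


Lemma centH_invol x : x \in H -> #[x] = 2 -> 2.-group (A x).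
Proof.
move=> Hx ox; have [abC _] := invol_cent1 (subsetP sHG x Hx) ox.
exact: pgroupS (setSI _ sHG) (abelem_pgroup abC).
Qed.

(** The index of A x in NH x is at most that of C x in N x, which is 2. *)
Lemma centH_torus x : x \in H^# -> #[x] != 2 ->
  [/\ odd #|A x|, (2 < #|A x|)%N & NH x = A x \/ #|NH x| = (2 * #|A x|)%N].
Proof.
move=> H1x nox; have G1x := sub1 H1x; have sAC : A x \subset C x by exact: setSI.
have [_ _ oddC oN invN] := torus_cent1 G1x nox.
have oddA : odd #|A x| by apply: dvdn_odd oddC; apply: cardSg.
have A_gt1 : (1 < #|A x|)%N.
  by rewrite cardG_gt1; apply/trivgPn; exists x; have /setD1P[] := mem_centH H1x.
have EA : A x = NH x :&: C x.
  apply/setP=> y; apply/idP/idP=> [Ay | /setIP[/setIP[Hy _] /setIP[_ cxy]]].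
    by rewrite in_setI (subsetP (centH_sub_norm x)) ?(subsetP sAC).
  by rewrite inE Hy.
split=> //; first by move: oddA A_gt1; case: #|A x| => [|[|[]]].
have [sNC | nsNC] := boolP (NH x \subset C x).
  by left; apply/eqP; rewrite eqEsubset centH_sub_norm andbT EA subsetI subxx sNC.
right; have sNHN : NH x \subset N x by exact: setSI.
have idx_le2 : (#|NH x : C x| <= 2)%N.
  have -> : 2 = #|N x : C x|.
    by rewrite -divgS ?cent1_sub_norm // oN mulnK.
  exact: subset_leq_card (imsetS _ sNHN).
have idx_gt1 : (1 < #|NH x : C x|)%N by rewrite indexg_gt1.
rewrite -(Lagrange (centH_sub_norm x)) mulnC; congr (_ * _)%N.
by rewrite /= EA indexgI; apply/eqP; rewrite eqn_leq idx_le2.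
Qed.

(** The share of a torus of order t is at least (t - 1) / (2 t), and t >= 3. *)
Lemma torus_support_bound x : x \in H^# -> #[x] != 2 -> (#|H| <= 3 * #|U x|)%N.
Proof.
move=> H1x nox; have := card_support H1x; have [oddA A_gt2 [-> | ->]] := centH_torus H1x nox.
  nia.
nia.
Qed.

(** A self-normalizing torus of order t has the share (t - 1) / t. *)
Lemma torus_support_bound2 x : x \in H^# -> #[x] != 2 -> NH x = A x ->
  (2 * #|H| <= 3 * #|U x|)%N.
Proof.
move=> H1x nox NA; have := card_support H1x; rewrite NA.
have [_ A_gt2 _] := centH_torus H1x nox; nia.
Qed.

Lemma support_full_norm x : x \in H^# -> #|NH x| = #|A x| -> U x = H^# -> H \subset C x.
Proof.
move=> H1x oN UH; have := card_support H1x; rewrite UH oN.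
have := cardsD1 1 H; rewrite group1 add1n => oH oUA.
have A_gt0 := cardG_gt0 (A x).
have arith u a h : h = u.+1 -> (u * a = (a - 1) * h)%N -> 0 < a -> h = a.
  by move=> ->; case: a => // a; nia.
have oHA : #|H| = #|A x| := arith _ _ _ oH oUA A_gt0.
have /eqP <- : A x == H by rewrite eqEcard subsetIl oHA /=.
exact: setSI.
Qed.

(** If H has odd order then its parts are self-normalizing, so each class of parts
    fills at least two thirds of H: there is only one class, and it has only one
    member. *)
Lemma odd_sub_cent1 x : odd #|H| -> x \in H^# -> H \subset C x.
Proof.
move=> oddH H1x.
have no_invol y : y \in H -> #[y] != 2.
  by move=> Hy; apply: contraTneq (dvdn_odd (order_dvdG Hy) oddH) => ->.
have NA y : y \in H^# -> NH y = A y.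
  move=> H1y; have [_ Hy] := setD1P H1y.
  have [_ _ [//|oN]] := centH_torus H1y (no_invol y Hy).
  have := dvdn_odd (cardSg (subsetIl H 'N(C y))) oddH.
  by rewrite oN oddM.
have [UH | [y H1y Uy]] := support_cover (support_sub x).
  apply: support_full_norm; rewrite ?NA //.
  by apply/eqP; rewrite eqEcard support_sub UH [#|H|](cardsD1 1) group1 /=.
have := torus_support_bound2 H1x (no_invol x (setD1P H1x).2) (NA x H1x).
have := torus_support_bound2 H1y (no_invol y (setD1P H1y).2) (NA y H1y).
have : #|U x :|: U y| <= #|H|.-1.
  have -> : #|H|.-1 = #|H^#| by rewrite [#|H|](cardsD1 1) group1.
  by rewrite subset_leq_card // subUset !support_sub.
rewrite card_support2 //; have := cardG_gt0 H; lia.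
Qed.


End Subgroup.

Lemma cent1_normal x : C x <| N x.
Proof. by rewrite normal_subnorm subsetIl. Qed.

Lemma invol_sub1 x : x \in G -> #[x] = 2 -> x \in G^#.
Proof. by move=> Gx ox; rewrite in_setD1 -order_eq1 ox. Qed.

Lemma cent1_Hall_invol x : x \in G -> #[x] = 2 -> 2.-Hall(N x) (C x).
Proof.
move=> Gx ox; have [abC oC] := invol_cent1 Gx ox.
rewrite /pHall cent1_sub_norm (abelem_pgroup abC) -divgS ?cent1_sub_norm //=.
rewrite card_norm_invol // oC mulKn ?(ltn_trans _ q_gt2) //.
by rewrite p'natE // dvdn2; lia.
Qed.

Lemma invol_norm_invol x v : x \in G -> #[x] = 2 -> v \in N x -> #[v] = 2 ->
  v \in C x.
Proof.
move=> Gx ox Nv ov.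
by rewrite (mem_normal_Hall (cent1_Hall_invol Gx ox)) ?cent1_normal // /p_elt ov.
Qed.

(** Otherwise N x contains an involution v that inverts y.  It lies in the normal
    Sylow 2-subgroup C x, and so does y ^- 2, a product of v and a conjugate of
    v, although y has odd order. *)
Lemma borel_setI_torus_norm x y : x \in G -> #[x] = 2 -> y \in G^# -> #[y] != 2 ->
  y \in N x -> N x :&: N y \subset C y.
Proof.
move=> Gx ox G1y noy Nxy; apply/subsetP=> v /setIP[Nxv Nyv].
apply: contraT => not_Cv; have [_ _ oddC _ invN] := torus_cent1 G1y noy.
have [ov inv_v] : #[v] = 2 /\ {in C y, forall w, w ^ v = w^-1}.
  by apply: invN; rewrite inE not_Cv.
have Cy := mem_cent1 G1y.
have Cxv := invol_norm_invol Gx ox Nxv ov.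
have Cxy2 : y ^+ 2 \in C x.
  have -> : y ^+ 2 = (v^-1 * v ^ y^-1)^-1.
    have -> : v^-1 * v ^ y^-1 = y ^ v * y^-1 by rewrite !conjgE invgK !mulgA.
    by rewrite inv_v // invMg !invgK expgS expg1.
  have nCy : y \in 'N(C x) by case/setIP: Nxy.
  by rewrite groupV groupM ?groupV // memJ_norm ?groupV.
have y2 : y ^+ 2 = 1.
  apply: (odd_group_sqr1 oddC); rewrite ?groupX //.
  by have [/abelemP[] // _ -> //] := invol_cent1 Gx ox.
by case/setD1P: G1y => /eqP[]; apply: (odd_group_sqr1 oddC Cy y2).
Qed.

Lemma torus_norm_odd y v : y \in G^# -> #[y] != 2 -> v \in N y -> #[v] != 2 ->
  v \in C y.
Proof.
move=> G1y noy Nv nov; apply: contraT => not_Cv.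
have [_ _ _ _ invN] := torus_cent1 G1y noy.
by case/eqP: nov; have [|//] := invN v; rewrite inE not_Cv.
Qed.

(** The complement given by the theorem of Schur and Zassenhaus has odd order
    q - 1, so it lies in a torus; it is the whole torus, as q - 1 does not divide
    q + 1. *)
Lemma borel_complement x : x \in G -> #[x] = 2 ->
  exists y, [/\ y \in G^#, #[y] != 2, #|C y| = (q - 1)%N & C x ><| C y = N x].
Proof.
move=> Gx ox; have [abC oC] := invol_cent1 Gx ox.
have hallC := cent1_Hall_invol Gx ox.
have /splitsP[K /complP[tiCK defN]] := SchurZassenhaus_split (pHall_Hall hallC) (cent1_normal x).
have oK : #|K| = (q - 1)%N.
  have := TI_cardMg tiCK; rewrite defN card_norm_invol // oC.
  by move/eqP; rewrite eqn_pmul2l ?(ltn_trans _ q_gt2) // => /eqP.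
have sKN : K \subset N x by rewrite -defN mulG_subr.
have sKG : K \subset G := subset_trans sKN (subsetIl _ _).
have oddK : odd #|K| by rewrite oK; lia.
have /trivgPn[y Ky nty] : K :!=: 1 by rewrite -cardG_gt1 oK; lia.
have K1y : y \in K^# by rewrite in_setD1 nty.
have G1y : y \in G^# by rewrite in_setD1 nty (subsetP sKG).
have noy : #[y] != 2 by apply: contraTneq (dvdn_odd (order_dvdG Ky) oddK) => ->.
have sKC := odd_sub_cent1 sKG oddK K1y.
have [_ oCy _ _ _] := torus_cent1 G1y noy.
have oCy1 : #|C y| = (q - 1)%N.
  case: oCy => // oCy; have := cardSg sKC; rewrite oK oCy.
  by move/dvdn_sub1_add1; rewrite leqNgt q_gt3.
exists y; split=> //.
have /eqP eqKC : K :==: C y by rewrite eqEcard sKC oCy1 oK /=.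
rewrite -eqKC sdprodE //; first exact: subset_trans sKN (subsetIr _ _).
Qed.

Lemma norm_solvable x : x \in G^# -> solvable (N x).
Proof.
move=> G1x; rewrite (series_sol (cent1_normal x)) abelian_sol ?cent1_abelian //=.
have [ox | nox] := eqVneq #[x] 2.
  have Gx := (setD1P G1x).2; have [y [G1y _ _ /sdprodP[_ defN nCC _]]] := borel_complement Gx ox.
  rewrite -defN quotientMidl; apply: quotient_sol.
  exact: abelian_sol (cent1_abelian G1y).
have [_ _ _ oN _] := torus_cent1 G1x nox.
apply/abelian_sol/cyclic_abelian/prime_cyclic.
by rewrite card_quotient ?subsetIr // -divgS ?cent1_sub_norm // oN mulnK.
Qed.

(** N x is soluble, so y is conjugate in N x to an element of the complement
    given by borel_complement, and that complement is a centralizer. *)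
Lemma torus_in_borel x y : x \in G -> #[x] = 2 -> y \in G^# -> #[y] != 2 ->
  y \in N x -> C y \subset N x /\ #|C y| = (q - 1)%N.
Proof.
move=> Gx ox G1y noy Ny; have [w [G1w now oCw defN]] := borel_complement Gx ox.
have hallCw : 2^'.-Hall(N x) (C w).
  rewrite -(compl_pHall _ (cent1_Hall_invol Gx ox)).
  by have [_ mulCC _ tiCC] := sdprodP defN; apply/complP.
have sol := norm_solvable (invol_sub1 Gx ox).
have [_ _ oddC _ _] := torus_cent1 G1y noy.
have p'y : 2^'.-group <[y]>.
  by rewrite /pgroup -orderE p'natE // dvdn2 (dvdn_odd (order_dvdG (mem_cent1 G1y))).
have [|g Ng] := Hall_Jsub (K := <[y]>) sol hallCw _ p'y; first by rewrite cycle_subG.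
rewrite -cycleJ cycle_subG => Cwyg; have [Gg _] := setIP Ng.
have eqC : C w = C y :^ g.
  rewrite subcent1J //; apply/esym/cent1_sub_eq; rewrite // in_setD1 Cwyg conjg_eq1.
  by rewrite (setD1P G1y).1.
split; last by rewrite -oCw eqC cardJg.
have -> : C y = C w :^ g^-1 by rewrite eqC conjsgK.
have sCN : C w \subset N x by have [_ <- _ _] := sdprodP defN; apply: mulG_subr.
by rewrite sub_conjgV conjGid.
Qed.

(** A nontrivial r-group has a nontrivial central element c, and its elements
    other than 1 have the same centralizer as c. *)
Lemma pgroup_sub_cent1 (S : {group gT}) (r : nat) x :
  r.-group S -> S \subset G -> x \in S^# -> S \subset C x.
Proof.
move=> rS sSG /setD1P[ntx Sx].
have ntS : S :!=: 1 by apply/trivgPn; exists x.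
have: 'Z(S) != 1 by rewrite (center_nil_eq1 (pgroup_nil rS)).
case/trivgPn=> c /centerP[Sc cSc] ntc.
have G1c : c \in G^# by rewrite in_setD1 ntc (subsetP sSG).
have sSC : S \subset C c.
  by rewrite subsetI sSG sub_cent1; apply/centP=> y Sy; rewrite /commute cSc.
by rewrite (cent1_sub_eq G1c) // in_setD1 ntx (subsetP sSC).
Qed.

Section Dickson.

Variable H : {group gT}.
Hypothesis sHG : H \subset G.

Local Notation A x := ('C_H[x]).
Local Notation NH x := ('N_H('C_G[x])).
Local Notation U x := (class_support (A x)^# H).

(** By pgroup_sub_cent1 a Sylow r-subgroup of H lies in a single part, so two
    parts whose orders are divisible by r are conjugate. *)
Lemma support_common_prime r x y : prime r -> x \in H^# -> y \in H^# ->
  r %| #|A x| -> r %| #|A y| -> y \in U x.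
Proof.
move=> pr_r H1x H1y rAx rAy.
have G1 z : z \in H^# -> z \in G^#.
  by case/setD1P=> ntz Hz; rewrite in_setD1 ntz (subsetP sHG).
have ntr (z : gT) : #[z] = r -> z != 1 by move=> oz; rewrite -order_gt1 oz prime_gt1.
have [x' Ax' ox'] := Cauchy pr_r rAx; have [y' Ay' oy'] := Cauchy pr_r rAy.
have eqC z z' : z \in H^# -> z' \in A z -> #[z'] = r -> C z' = C z.
  move=> H1z Az' oz'; apply: (cent1_sub_eq (G1 z H1z)).
  by rewrite in_setD1 ntr // (subsetP (setSI _ sHG)).
have r_cycle (z : gT) : #[z] = r -> r.-group <[z]>.
  by move=> oz; rewrite /pgroup -orderE oz pnat_id.
have Hx' : x' \in H by case/setIP: Ax'.
have Hy' : y' \in H by case/setIP: Ay'.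
have sxH : <[x']> \subset H by rewrite cycle_subG.
have syH : <[y']> \subset H by rewrite cycle_subG.
have [S sylS sxS] := Sylow_superset sxH (r_cycle x' ox').
have [g Hg] := Sylow_Jsub sylS syH (r_cycle y' oy').
rewrite -cycleJ cycle_subG => Sy'g; rewrite cycle_subG in sxS.
have sSC : S \subset C x.
  rewrite -(eqC x x') //; apply: pgroup_sub_cent1 (pHall_pgroup sylS) _ _.
    exact: subset_trans (pHall_sub sylS) sHG.
  by rewrite in_setD1 ntr.
apply/(support_cent1 sHG H1x H1y); exists g^-1; first by rewrite groupV.
rewrite -(@cent1_sub_eq x (y' ^ g)) ?G1 //; last first.
  by rewrite in_setD1 conjg_eq1 ntr // (subsetP sSC).
by rewrite -subcent1J ?(subsetP sHG) // conjsgK (eqC y y').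
Qed.

Hypothesis nonorm : {in G^#, forall x, ~~ (H \subset N x)}.

Lemma leq_double_norm x : x \in H^# -> (2 * #|NH x| <= #|H|)%N.
Proof.
move=> H1x; have G1x : x \in G^#.
  by case/setD1P: H1x => ntx Hx; rewrite in_setD1 ntx (subsetP sHG).
rewrite -(Lagrange (subsetIl H 'N(C x))) mulnC leq_mul2l indexg_gt1.
apply/orP; right; apply: contra (nonorm G1x) => sHN.
rewrite subsetI sHG; exact: subset_trans sHN (subsetIr _ _).
Qed.

Lemma dickson_invol : exists2 z, z \in H & #[z] = 2.
Proof.
suff dv2 : 2 %| #|H| by have [z Hz oz] := Cauchy (isT : prime 2) dv2; exists z.
rewrite dvdn2; apply/negP=> oddH.
have [H1 | /trivgPn[x Hx ntx]] := eqVneq (H : {set gT}) 1.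
  have dv2 : 2 %| #|G|.
    by rewrite (card_SL2_even SL2_G) -mulnA dvdn_mulr // dvdn2.
  have [z Gz oz] := Cauchy (isT : prime 2) dv2.
  by case/negP: (nonorm (invol_sub1 Gz oz)); rewrite H1 sub1G.
have H1x : x \in H^# by rewrite in_setD1 ntx.
have G1x : x \in G^# by rewrite in_setD1 ntx (subsetP sHG).
case/negP: (nonorm G1x).
exact: subset_trans (odd_sub_cent1 sHG oddH H1x) (cent1_sub_norm x).
Qed.

(** A complement K of A z in NH z acts on A z without fixed points, so its order
    k divides |A z| - 1.  If K is not trivial it is a part of H: the torus of
    G that contains it normalizes C z, so it meets H inside NH z. *)
Lemma dickson_borel z : z \in H -> #[z] = 2 -> exists k,
  [/\ #|NH z| = (#|A z| * k)%N, odd k, k %| #|A z| - 1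
   & 1 < k -> exists2 y, y \in H^# & [/\ #[y] != 2, #|A y| = k & k %| q - 1]].
Proof.
move=> Hz oz; have Gz := subsetP sHG z Hz.
have sAC : A z \subset C z by exact: setSI.
have sNHN : NH z \subset N z by exact: setSI.
have EA : A z = C z :&: NH z.
  apply/setP=> y; apply/idP/idP=> [Ay | /setIP[/setIP[_ czy] /setIP[Hy _]]].
    by rewrite in_setI (subsetP (centH_sub_norm sHG z)) ?(subsetP sAC).
  by rewrite inE Hy.
have nA : A z <| NH z.
  by have := normalGI sNHN (cent1_normal z); rewrite [NH z :&: C z]setIC -EA.
have hallA : 2.-Hall(NH z) (A z).
  by rewrite EA; apply: setI_normal_Hall (cent1_normal z) (cent1_Hall_invol Gz oz) sNHN.
have /splitsP[K complK] := SchurZassenhaus_split (pHall_Hall hallA) nA.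
have oddK : odd #|K|.
  move: complK; rewrite (compl_pHall _ hallA) => /pHall_pgroup.
  by rewrite /pgroup p'natE // dvdn2 negbK.
have [tiAK defNH] := complP complK.
have sKNH : K \subset NH z by rewrite -defNH mulG_subr.
have sKH : K \subset H := subset_trans sKNH (subsetIl _ _).
have sKG : K \subset G := subset_trans sKH sHG.
have nKA : K \subset 'N(A z) := subset_trans sKNH (normal_norm nA).
have torusK y : y \in K^# -> y \in G^# /\ #[y] != 2.
  case/setD1P=> nty Ky; rewrite in_setD1 nty (subsetP sKG) //; split=> //.
  by apply: contraTneq (dvdn_odd (order_dvdG Ky) oddK) => ->.
have k_dv : #|K| %| #|A z|.-1.
  apply: regular_norm_dvd_pred => // y K1y; have [G1y noy] := torusK y K1y.
  have [_ _ oddC _ _] := torus_cent1 G1y noy.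
  apply/trivgP/subsetP=> a /setIP[Aa /cent1P comm_ay]; rewrite inE.
  apply: contraLR oddC => nta; have Ca := subsetP sAC a Aa.
  have C1a : a \in (C y)^#.
    by rewrite in_setD1 nta inE (setIP Ca).1 cent1C; apply/cent1P.
  rewrite -(cent1_sub_eq G1y C1a).
  have oa : #[a] = 2 by apply: mem_invol_cent1 Gz oz _; rewrite in_setD1 nta.
  by have [_ ->] := invol_cent1 (setIP Ca).1 oa.
exists #|K|; split=> //.
- by rewrite -(TI_cardMg tiAK) defNH.
- by rewrite subn1.
rewrite cardG_gt1 => /trivgPn[y Ky nty].
have K1y : y \in K^# by rewrite in_setD1 nty.
have [G1y noy] := torusK y K1y.
have sKC := odd_sub_cent1 sKG oddK K1y.
have Ny : y \in N z by rewrite (subsetP sNHN) ?(subsetP sKNH).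
have [sCN oC] := torus_in_borel Gz oz G1y noy Ny.
have [_ _ oddC _ _] := torus_cent1 G1y noy.
exists y; first by rewrite in_setD1 nty (subsetP sKH).
split=> //; last by rewrite -oC cardSg.
apply/eqP; rewrite eqn_dvd.
have sAN : A y \subset NH z.
  rewrite subsetI subsetIl (subset_trans (setSI _ sHG)) //.
  exact: subset_trans sCN (subsetIr _ _).
apply/andP; split.
  have oddA : odd #|A y| by apply: dvdn_odd oddC; apply/cardSg/setSI.
  have : #|A y| %| #|A z| * #|K| by rewrite -(TI_cardMg tiAK) defNH cardSg.
  rewrite Gauss_dvdr //.
  have : 2.-nat #|A z| := centH_invol sHG Hz oz.
  by apply: p'nat_coprime; rewrite p'natE // dvdn2 negbK.
by apply: cardSg; rewrite subsetI sKH; apply: subset_trans sKC (subsetIr _ _).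
Qed.

Lemma support_invol z w : z \in H -> #[z] = 2 -> w \in H^# -> #[w] = 2 -> w \in U z.
Proof.
move=> Hz oz H1w ow; have [ntw Hw] := setD1P H1w.
apply: (@support_common_prime 2) => //.
- by rewrite in_setD1 -order_eq1 oz.
- by rewrite -oz order_dvdG // inE Hz cent1id.
- by rewrite -ow order_dvdG // inE Hw cent1id.
Qed.

Lemma support_torus z y : z \in H -> #[z] = 2 -> y \in H^# -> #[y] != 2 -> y \notin U z.
Proof.
move=> Hz oz H1y noy; apply: contra noy => /imset2P[a g A1a Hg ->].
rewrite orderJ; apply/eqP; apply: mem_invol_cent1 (subsetP sHG z Hz) oz _.
by have [nta Aa] := setD1P A1a; rewrite in_setD1 nta (subsetP (setSI _ sHG)).
Qed.

Lemma coprime_tori x y : x \in H^# -> y \in H^# -> y \notin U x -> coprime #|A x| #|A y|.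
Proof.
move=> H1x H1y; apply: contraR => ncop.
have [| r pr_r] := pdivP (_ : 1 < gcdn #|A x| #|A y|).
  by rewrite ltn_neqAle eq_sym ncop gcdn_gt0 cardG_gt0.
by rewrite dvdn_gcd => /andP[]; apply: support_common_prime.
Qed.

Lemma leq_card_support3 x y w : x \in H^# -> y \in H^# -> w \in H^# ->
  y \notin U x -> w \notin U x :|: U y -> (#|U x| + #|U y| + #|U w| <= #|H|.-1)%N.
Proof.
move=> H1x H1y H1w Uxy Uw; rewrite -(card_support3 sHG) //.
have -> : #|H|.-1 = #|H^#| by rewrite [#|H|](cardsD1 1) group1.
by rewrite subset_leq_card // !subUset !support_sub.
Qed.

Lemma leq_card_support4 x y w v : x \in H^# -> y \in H^# -> w \in H^# -> v \in H^# ->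
  y \notin U x -> w \notin U x :|: U y -> v \notin U x :|: U y :|: U w ->
  (#|U x| + #|U y| + #|U w| + #|U v| <= #|H|.-1)%N.
Proof.
move=> H1x H1y H1w H1v Uxy Uw Uv; rewrite -(card_support3 sHG) //.
have -> : #|H|.-1 = #|H^#| by rewrite [#|H|](cardsD1 1) group1.
have [Uxv Uyv Uwv] : [/\ v \notin U x, v \notin U y & v \notin U w].
  by move: Uv; rewrite 2!in_setU !negb_or -andbA => /and3P[].
have dis t : t \in H^# -> v \notin U t -> U t :&: U v = set0.
  by move=> H1t Utv; apply/eqP; rewrite setI_eq0 support_disjoint.
have /eqP <- : #|U x :|: U y :|: U w :|: U v| == (#|U x :|: U y :|: U w| + #|U v|)%N.
  by rewrite (leq_card_setU _ _).2 -setI_eq0 !setIUl !dis // !setU0.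
by rewrite subset_leq_card // !subUset !support_sub.
Qed.

(** The involutions of H form one class, of share (s - 1) / (s k).  For k = 1 it is
    at least 1 / 2, so at most one other class remains, and the equation fails.
    For k > 1 the class of the torus of order k gives the total 1 - 1 / (s k) if
    this torus is self-normalizing, which fails too; otherwise exactly one more
    class of tori, of order t, must be added.  As s, k and t are pairwise coprime
    divisors of |H|, the equation then has a single solution. *)
Theorem dickson_order : exists s,
  [/\ #|H| = (s * (s - 1) * (s + 1))%N, 2.-nat s, 3 < s & (s - 1 %| q - 1)%N].
Proof.
have [z Hz oz] := dickson_invol.
have [k [oNz odd_k k_dv borel]] := dickson_borel Hz oz.
have H1z : z \in H^# by rewrite in_setD1 -order_eq1 oz.
have torus w : w \in H^# -> w \notin U z -> #[w] != 2.
  by move=> H1w; apply: contra => /eqP; apply: support_invol.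
have s_even : ~~ odd #|A z|.
  by rewrite -dvdn2 -oz order_dvdG // inE Hz cent1id.
have s_gt0 : 0 < #|A z| := cardG_gt0 _.
have h_gt0 : 0 < #|H| := cardG_gt0 _.
have Uz := card_support sHG H1z; rewrite oNz in Uz.
have ltz := leq_double_norm H1z; rewrite oNz in ltz.
have subU2 y : U z :|: U y \subset H^# by rewrite subUset !support_sub.
have sum3 x y w := @leq_card_support3 x y w.
have sum2 x y : x \in H^# -> y \in H^# -> y \notin U x -> (#|U x| + #|U y| <= #|H|.-1)%N.
  move=> H1x H1y Uxy; rewrite -(card_support2 sHG) //.
  have -> : #|H|.-1 = #|H^#| by rewrite [#|H|](cardsD1 1) group1.
  by rewrite subset_leq_card // subUset !support_sub.
have [k_le1 | k_gt1] := leqP k 1.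
  have k1 : k = 1%N by move: k_le1 odd_k; clear; case: k => [|[]].
  rewrite {}k1 muln1 in Uz ltz.
  have s_gt1 : 1 < #|A z| by case: #|A z| s_even s_gt0 => [|[]].
  have Uz_big := half_share Uz s_gt1.
  case: (support_cover (support_sub H z)) => [UzH | [y H1y Uy]].
    by case: (share_lt_all Uz UzH h_gt0 s_gt0 ltz).
  have [odd_t t_gt2 [NHy | oNy]] := centH_torus sHG H1y (torus y H1y Uy).
    have Uy_big := torus_support_bound2 sHG H1y (torus y H1y Uy) NHy.
    by case: (shares_lt1_2 Uz_big Uy_big h_gt0); apply: sum2.
  have UyN := card_support sHG H1y; rewrite oNy in UyN.
  have lty := leq_double_norm H1y; rewrite oNy in lty.
  case: (support_cover (subU2 y)) => [UH | [w H1w Uw]].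
    rewrite (card_support2 sHG) // in UH.
    by case: (dickson_arith_dihedral Uz UyN UH).
  have Uzw : w \notin U z by apply: contra Uw; rewrite inE => ->.
  have Uy_big := torus_support_bound sHG H1y (torus y H1y Uy).
  have Uw_big := torus_support_bound sHG H1w (torus w H1w Uzw).
  by case: (shares_lt1_3 Uz_big Uy_big Uw_big h_gt0); apply: sum3.
have [y H1y [noy oAy k_dvq]] := borel k_gt1.
have Uy := support_torus Hz oz H1y noy.
have k_gt2 : 2 < k by move: k_gt1 odd_k; clear; case: k => [|[|[]]].
have k_gt0 : 0 < k := ltnW k_gt1.
have s_gt3 : 3 < #|A z|.
  move: k_dv s_even s_gt0 k_gt2; clear; case: #|A z| => [|[|s]] // k_dv _ _ k_gt2.
  by have := dvdn_leq (ltn0Sn s) k_dv; clear k_dv; lia.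
have [odd_t t_gt2 [NHy | oNy]] := centH_torus sHG H1y noy.
  have UyN := card_support sHG H1y; rewrite NHy oAy in UyN.
  have sk_gt3 : 3 < #|A z| * k.
    by apply: leq_trans s_gt3 _; rewrite leq_pmulr.
  have [neq absurd3] := dickson_arith_frobenius Uz UyN sk_gt3 s_gt0 k_gt0 ltz.
  case: (support_cover (subU2 y)) => [UH | [w H1w Uw]].
    by case: neq; rewrite -UH (card_support2 sHG).
  case: (absurd3 #|U w|); last exact: sum3.
  apply: torus_support_bound => //; apply: torus => //.
  by apply: contra Uw; rewrite inE => ->.
have UyN := card_support sHG H1y; rewrite oNy oAy in UyN.
have [neq absurd3] := dickson_arith_half Uz UyN s_gt3 k_gt2 ltz.
case: (support_cover (subU2 y)) => [UH | [w H1w Uw]].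
  by case: neq; rewrite -UH (card_support2 sHG).
have [Uzw Uyw] : w \notin U z /\ w \notin U y.
  by apply/norP; rewrite inE in Uw.
have now := torus w H1w Uzw.
have [odd_w w_gt2 [NHw | oNw]] := centH_torus sHG H1w now.
  case: (absurd3 #|U w|); last exact: sum3.
  exact: torus_support_bound2.
have UwN := card_support sHG H1w; rewrite oNw in UwN.
have subU3 : U z :|: U y :|: U w \subset H^# by rewrite subUset subU2 support_sub.
(* A fourth class would fill another third of H, with the third class two thirds. *)
case: (support_cover subU3) => [UH | [v H1v Uv]]; last first.
  have nov : #[v] != 2 by apply: torus => //; apply: contra Uv; rewrite !inE => ->.
  case: (absurd3 (#|U w| + #|U v|)%N); last first.
    by rewrite addnA; apply: leq_card_support4.
  rewrite mulnDr mul2n -addnn leq_add //; exact: torus_support_bound.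
rewrite (card_support3 sHG) // in UH.
have skt_dv : #|A z| * k * #|A w| %| #|H|.
  have [cop_zy cop_zw cop_yw] := And3 (coprime_tori H1z H1y Uy)
    (coprime_tori H1z H1w Uzw) (coprime_tori H1y H1w Uyw).
  rewrite -oAy !Gauss_dvd ?coprimeMl ?cop_zw //.
  by rewrite !cardSg ?subsetIl.
have [Dk Dt Dh] :=
  dickson_arith_SL2 Uz UyN UwN UH h_gt0 s_gt3 s_even k_gt2 odd_k odd_w k_dv skt_dv.
exists #|A z|; split=> //.
- by rewrite Dh Dk Dt.
- exact: centH_invol.
- by rewrite -Dk.
Qed.

End Dickson.

Lemma torus_norm_dihedral x : x \in G^# -> #[x] != 2 -> N x \isog 'D_(2 * #|C x|).
Proof.
move=> G1x nox; have [/cyclicP[a Da] _ oddC oN invN] := torus_cent1 G1x nox.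
have ca_gt1 : 1 < #|C x|.
  by rewrite cardG_gt1; apply/trivgPn; exists x; rewrite ?mem_cent1 ?(setD1P G1x).1.
have [v Nv not_Cv] : exists2 v, v \in N x & v \notin C x.
  apply/subsetPn/negP=> /subset_leq_card; rewrite oN leqNgt ltn_Pmull //.
have [|ov inv_v] := invN v; first by rewrite inE not_Cv.
have Ca : a \in C x by rewrite Da cycle_id.
rewrite isogEcard mul2n card_dihedral // oN mul2n leqnn andbT.
rewrite Grp_dihedral //; apply/existsP; exists (a, v) => /=.
rewrite !xpair_eqE inv_v // eqxx andbT -{1}ov expg_order eqxx andbT.
rewrite {2}Da -orderE expg_order eqxx andbT eqEcard join_subG !cycle_subG Nv.
rewrite (subsetP (cent1_sub_norm x)) //= -(Lagrange (cent1_sub_norm x)).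
have sCJ : C x \subset <[a]> <*> <[v]> by rewrite Da joing_subl.
have -> : #|N x : C x| = 2 by rewrite -divgS ?cent1_sub_norm // oN mulnK.
rewrite -(Lagrange sCJ) leq_mul2l indexg_gt1; apply/orP; right.
by apply: contra not_Cv => /subsetP; apply; rewrite mem_gen // inE cycle_id orbT.
Qed.

(** K normalizes a nontrivial abelian subgroup, whose elements other than 1 lie in
    a single part of G. *)
Lemma solvable_sub_norm (K : {group gT}) : K \subset G -> solvable K -> K :!=: 1 ->
  exists2 x, x \in G^# & K \subset N x.
Proof.
move=> sKG solK ntK.
have [M [sMK nKM ntM abM]] := solvable_norm_abelem solK (normal_refl K) ntK.
have cMM : abelian M by have [r _ /abelem_abelian] := is_abelemP abM.
have /trivgPn[x Mx ntx] := ntM; have sMG := subset_trans sMK sKG.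
have G1x : x \in G^# by rewrite in_setD1 ntx (subsetP sMG).
have C1x : x \in (C x)^# by rewrite in_setD1 ntx mem_cent1.
exists x => //; apply/subsetP=> g Kg; have Gg := subsetP sKG g Kg.
rewrite -(conj_mem_cent1 G1x C1x Gg).
have Mxg : x ^ g \in M by rewrite memJ_norm // (subsetP (normal_norm nKM)).
apply/setIP; split; first by rewrite (subsetP sMG).
by apply/cent1P; apply: (centsP cMM).
Qed.

Lemma norm_proper x : x \in G^# -> N x \proper G.
Proof.
move=> G1x; rewrite properEcard subsetIl /= (card_SL2_even SL2_G).
have [ltB lt1 lt2] := norm_orders_lt_SL2 q_gt2; have [_ Gx] := setD1P G1x.
have [ox | nox] := eqVneq #[x] 2; first by rewrite card_norm_invol.
by have [_ oC _ -> _] := torus_cent1 G1x nox; case: oC => ->.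
Qed.

(** x lies in N y, so C x = C y unless exactly one of x and y is an involution.
    If y is one, then N x would be contained in C x; if x is one, then q would
    divide the order of N y, twice an odd number. *)
Lemma norm_sub_cent1_eq x y : x \in G^# -> y \in G^# -> N x \subset N y -> C x = C y.
Proof.
move=> G1x G1y sNN; have Cx := mem_cent1 G1x; have [ntx Gx] := setD1P G1x.
have Nx : x \in N x := subsetP (cent1_sub_norm x) x Cx.
have Nyx := subsetP sNN x Nx.
have [oy | noy] := eqVneq #[y] 2.
  have Gy := (setD1P G1y).2; have [ox | nox] := eqVneq #[x] 2.
    by apply: cent1_sub_eq; rewrite // in_setD1 ntx invol_norm_invol.
  have := borel_setI_torus_norm Gy oy G1x nox Nyx.
  rewrite (setIidPr sNN) => /subset_leq_card.
  by have [_ _ _ -> _] := torus_cent1 G1x nox; rewrite leqNgt ltn_Pmull.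
have [ox | nox] := eqVneq #[x] 2; last first.
  by apply: cent1_sub_eq; rewrite // in_setD1 ntx torus_norm_odd.
have [_ oC] := invol_cent1 Gx ox; have [_ _ oddC oN _] := torus_cent1 G1y noy.
have : #|C x| %| #|N y| by rewrite cardSg // (subset_trans (cent1_sub_norm x)).
rewrite oC oN Gauss_dvdl; first by move/dvdn_leq=> /(_ isT); rewrite leqNgt q_gt2.
by apply: pnat_coprime q_2 _; rewrite p'natE // dvdn2 negbK.
Qed.

Lemma norm_maximal x : x \in G^# ->
  (forall H, H \proper G -> exists2 y, y \in G^# & H \subset N y) ->
  maximal 'N_G(C x) G.
Proof.
move=> G1x sub_norm; apply/maxgroupP; split=> [|H prH sNH]; first exact: norm_proper.
have [y G1y sHN] := sub_norm H prH.
have eqC := norm_sub_cent1_eq G1x G1y (subset_trans sNH sHN).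
by apply/eqP; rewrite eqEsubset sNH /= eqC sHN.
Qed.


Lemma torus_not_invol x c : x \in G^# -> #|C x| = c -> c = (q - 1)%N \/ c = (q + 1)%N ->
  #[x] != 2.
Proof.
by move=> G1x oC Dc; rewrite cent1_invol // oC; case: Dc => ->; clear -q_gt2; lia.
Qed.

Lemma exists_invol : exists2 z, z \in G & #[z] = 2.
Proof.
have dv2 : 2 %| #|G| by rewrite (card_SL2_even SL2_G) -mulnA dvdn_mulr // dvdn2.
by have [z Gz oz] := Cauchy (isT : prime 2) dv2; exists z.
Qed.

Section TorusClasses.

Local Notation U x := (class_support (C x)^# G).

Let card_U_invol z : z \in G -> #[z] = 2 ->
  (#|U z| * (q * (q - 1)) = (q - 1) * (q * (q - 1) * (q + 1)))%N.
Proof.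
move=> Gz oz; have := card_support (subxx G) (invol_sub1 Gz oz).
have [_ ->] := invol_cent1 Gz oz.
by rewrite card_norm_invol // (card_SL2_even SL2_G).
Qed.

Let card_U_torus c x : x \in G^# -> #|C x| = c -> c = (q - 1)%N \/ c = (q + 1)%N ->
  (#|U x| * (2 * c) = (c - 1) * (q * (q - 1) * (q + 1)))%N.
Proof.
move=> G1x oC Dc; have := card_support (subxx G) G1x.
have [_ _ _ -> _] := torus_cent1 G1x (torus_not_invol G1x oC Dc).
by rewrite oC (card_SL2_even SL2_G).
Qed.

Let torus_notin_U z x : z \in G -> #[z] = 2 -> x \in G^# -> #[x] != 2 -> x \notin U z.
Proof. exact: (support_torus (subxx G)). Qed.

(** With two classes of split tori, the involutions and these two classes would
    leave exactly q elements of G different from 1, less than any further class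
    would need. *)
Lemma split_torus_conj x y : x \in G^# -> y \in G^# -> #|C x| = (q - 1)%N ->
  #|C y| = (q - 1)%N -> exists2 g, g \in G & C y = C x :^ g.
Proof.
move=> G1x G1y oCx oCy; have [z Gz oz] := exists_invol.
apply/(support_cent1 (subxx G) G1x G1y); apply: contraT => Uxy.
have c_eq : (q - 1)%N = (q - 1)%N \/ (q - 1)%N = (q + 1)%N by left.
have G1z := invol_sub1 Gz oz.
have nox := torus_not_invol G1x oCx c_eq; have noy := torus_not_invol G1y oCy c_eq.
have Uzx := torus_notin_U Gz oz G1x nox; have Uzy := torus_notin_U Gz oz G1y noy.
have EUz := card_U_invol Gz oz.
have EUx := card_U_torus G1x oCx c_eq; have EUy := card_U_torus G1y oCy c_eq.
have Ux_Uy : #|U x| = #|U y|.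
  apply/eqP; rewrite -(@eqn_pmul2r (2 * (q - 1))) ?EUx ?EUy //.
  by rewrite muln_gt0 subn_gt0 ltnW // ltnW.
have sum := SL2_torus_class_arith q_gt2 EUz EUx.
have Uzxy : y \notin U z :|: U x by rewrite inE negb_or Uzy.
have card3 := card_support3 (subxx G) G1z G1x G1y Uzx Uzxy.
rewrite -(card_SL2_even SL2_G) in sum.
have subU3 : U z :|: U x :|: U y \subset G^# by rewrite !subUset !support_sub.
case: (support_cover subU3) => [UG | [w G1w Uw]].
  by move: sum UG; rewrite card3 -Ux_Uy; clear -q_gt2; lia.
have [ow | now] := eqVneq #[w] 2.
  have := support_invol (subxx G) Gz oz G1w ow.
  by apply: contraLR => _; apply: contra Uw; rewrite !inE => ->.
have := torus_support_bound (subxx G) G1w now.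
have := leq_card_support4 (subxx G) G1z G1x G1y G1w Uzx Uzxy Uw.
rewrite -Ux_Uy => le1 le2.
have lt_q := mul4_lt_SL2_order q_gt3; rewrite -(card_SL2_even SL2_G) in lt_q.
move: #|U z| #|U x| #|U w| #|G| sum le1 le2 lt_q => a b c n; clear; lia.
Qed.

Lemma exists_split_torus : exists2 y, y \in G^# & #|C y| = (q - 1)%N.
Proof.
have [z Gz oz] := exists_invol.
by have [y [G1y _ oCy _]] := borel_complement Gz oz; exists y.
Qed.

(** The involutions and the split tori do not fill G. *)
Lemma exists_nonsplit_torus : exists2 w, w \in G^# & #|C w| = (q + 1)%N.
Proof.
have [z Gz oz] := exists_invol; have [y G1y oCy] := exists_split_torus.
have c_eq : (q - 1)%N = (q - 1)%N \/ (q - 1)%N = (q + 1)%N by left.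
have noy := torus_not_invol G1y oCy c_eq; have G1z := invol_sub1 Gz oz.
have Uzy := torus_notin_U Gz oz G1y noy.
have EUy := card_U_torus G1y oCy c_eq; have EUz := card_U_invol Gz oz.
have sum := SL2_torus_class_arith q_gt2 EUz EUy.
rewrite -(card_SL2_even SL2_G) in sum.
have subU2 : U z :|: U y \subset G^# by rewrite !subUset !support_sub.
case: (support_cover subU2) => [UG | [w G1w]].
  exfalso; move: UG sum; rewrite (card_support2 (subxx G)) //.
  move: #|U z| #|U y| #|G| => a b n; clear -q_gt2; lia.
rewrite inE negb_or => /andP[Uzw Uyw]; exists w => //.
have [ow | now] := eqVneq #[w] 2.
  by case/negP: Uzw; apply: (support_invol (subxx G)).
have [_ [oCw|//] _ _ _] := torus_cent1 G1w now.
case/negP: Uyw; apply/(support_cent1 (subxx G) G1y G1w).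
exact: split_torus_conj.
Qed.

(** Two classes of such tori would exceed the order of G. *)
Lemma nonsplit_torus_conj x y : x \in G^# -> y \in G^# -> #|C x| = (q + 1)%N ->
  #|C y| = (q + 1)%N -> exists2 g, g \in G & C y = C x :^ g.
Proof.
move=> G1x G1y oCx oCy; have [z Gz oz] := exists_invol.
apply/(support_cent1 (subxx G) G1x G1y); apply: contraT => Uxy.
have c_eq : (q + 1)%N = (q - 1)%N \/ (q + 1)%N = (q + 1)%N by right.
have G1z := invol_sub1 Gz oz.
have nox := torus_not_invol G1x oCx c_eq; have noy := torus_not_invol G1y oCy c_eq.
have Uzx := torus_notin_U Gz oz G1x nox; have Uzy := torus_notin_U Gz oz G1y noy.
have EUz := card_U_invol Gz oz.
have EUx := card_U_torus G1x oCx c_eq; have EUy := card_U_torus G1y oCy c_eq.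
have Ux_Uy : #|U x| = #|U y|.
  by apply/eqP; rewrite -(@eqn_pmul2r (2 * (q + 1))) ?EUx ?EUy // addn1.
have Uzxy : y \notin U z :|: U x by rewrite inE negb_or Uzy.
have := leq_card_support3 (subxx G) G1z G1x G1y Uzx Uzxy.
rewrite -Ux_Uy (card_SL2_even SL2_G).
by case/(SL2_nonsplit_class_arith q_gt2 EUz EUx).
Qed.

End TorusClasses.

Lemma invol_cent1_Sylow z : z \in G -> #[z] = 2 -> 'C_G[z]%G \in 'Syl_2(G).
Proof.
move=> Gz oz; have [abC oC] := invol_cent1 Gz oz.
rewrite inE /pHall subsetIl (abelem_pgroup abC) -divgS ?subsetIl //= oC.
rewrite (card_SL2_even SL2_G) -mulnA mulKn ?(ltn_trans _ q_gt2) //.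
by rewrite p'natE // dvdn2 oddM negbK !odd_torus_order; [|right|left].
Qed.

Lemma Sylow_invol_cent1 (P : {group gT}) : P \in 'Syl_2(G) ->
  exists2 z, z \in G & #[z] = 2 /\ P :=: C z.
Proof.
rewrite inE => sylP; have [z Gz oz] := exists_invol.
have s2z : <[z]> \subset G by rewrite cycle_subG.
have z_2 : 2.-group <[z]> by rewrite /pgroup -orderE oz.
have [g Gg] := Sylow_Jsub sylP s2z z_2; rewrite -cycleJ cycle_subG => Pzg.
exists (z ^ g); first by rewrite groupJ.
rewrite orderJ; split=> //.
have [abC _] := invol_cent1 (groupJ Gz Gg) (etrans (orderJ z g) oz).
apply/esym/(sub_pHall sylP); rewrite ?subsetIl ?(abelem_pgroup abC) //.
apply: pgroup_sub_cent1 (pHall_pgroup sylP) (pHall_sub sylP) _.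
by rewrite in_setD1 -order_eq1 orderJ oz.
Qed.

Lemma borel_order_neq_dihedral c : c = (q - 1)%N \/ c = (q + 1)%N -> (q * (q - 1))%N <> (2 * c)%N.
Proof. by case=> ->; clear -q_gt3; nia. Qed.

Lemma norm_isog_Borel w : w \in G^# -> isog_Borel G (N w) = (#[w] == 2).
Proof.
move=> G1w; have [_ Gw] := setD1P G1w; apply/existsP/eqP => [[P] | ow].
  case/andP=> sylP isoM; have [z Gz [oz DP]] := Sylow_invol_cent1 sylP.
  apply/eqP/contraT => now; have [_ oC _ oN _] := torus_cent1 G1w now.
  have := card_isog isoM; rewrite oN DP card_norm_invol // => /esym.
  by move/borel_order_neq_dihedral; case/(_ oC).
by exists 'C_G[w]%G; rewrite invol_cent1_Sylow //=; apply: isog_refl.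
Qed.

Lemma norm_isog_dihedral w c : w \in G^# -> c = (q - 1)%N \/ c = (q + 1)%N ->
  (N w \isog 'D_(2 * c)) = (#|C w| == c).
Proof.
move=> G1w Dc; have [_ Gw] := setD1P G1w.
have c_gt1 : 1 < c by case: Dc => ->; clear -q_gt2; lia.
apply/idP/eqP=> [isoM | oC]; last first.
  by have := torus_norm_dihedral G1w (torus_not_invol G1w oC Dc); rewrite oC.
have := card_isog isoM; rewrite mul2n card_dihedral // -mul2n.
have [ow | now] := eqVneq #[w] 2.
  by rewrite card_norm_invol // => /borel_order_neq_dihedral; case/(_ Dc).
by have [_ _ _ -> _] := torus_cent1 G1w now => /eqP; rewrite eqn_pmul2l // => /eqP.
Qed.

(** An involution of the intersection would centralize both z and w; so the
    intersection has odd order and lies in the part of x. *)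
Lemma borel_setI z w x : z \in G -> #[z] = 2 -> w \in G -> #[w] = 2 -> C z <> C w ->
  x \in G^# -> #[x] != 2 -> x \in N z -> x \in N w -> N z :&: N w = C x.
Proof.
move=> Gz oz Gw ow neqC G1x nox Nzx Nwx.
have sIG : N z :&: N w \subset G by rewrite subIset // subsetIl.
have G1z := invol_sub1 Gz oz; have G1w := invol_sub1 Gw ow.
apply/eqP; rewrite eqEsubset; apply/andP; split; last first.
  by rewrite subsetI (torus_in_borel Gz oz G1x nox Nzx).1 (torus_in_borel Gw ow G1x nox Nwx).1.
apply: odd_sub_cent1 => //; last by rewrite in_setD1 (setD1P G1x).1 inE Nzx.
rewrite -[odd _]negbK -dvdn2; apply/negP=> /(Cauchy (isT : prime 2))[u].
case/setIP=> Nzu Nwu ou; case: neqC.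
have ntu : u != 1 by rewrite -order_gt1 ou.
have Cuz : C u = C z.
  by apply: (cent1_sub_eq G1z); rewrite in_setD1 ntu; apply: invol_norm_invol Nzu ou.
have Cuw : C u = C w.
  by apply: (cent1_sub_eq G1w); rewrite in_setD1 ntu; apply: invol_norm_invol Nwu ou.
exact: etrans (esym Cuz) Cuw.
Qed.

Lemma norm_conj x g : g \in G -> N x :^ g = N (x ^ g).
Proof. by move=> Gg; rewrite conjIg conjGid // -normJ subcent1J. Qed.

Lemma invol_notin_torus x u : x \in G^# -> #[x] != 2 -> #[u] = 2 -> u \notin C x.
Proof.
move=> G1x nox ou; have [_ _ oddC _ _] := torus_cent1 G1x nox.
by apply: contraL oddC => /order_dvdG; rewrite ou dvdn2.
Qed.

(** C z acts by conjugation on the q + 1 Sylow 2-subgroups.  The stabilizer of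
    C z' is trivial, since two Borel subgroups meet in a group of odd order, so
    its orbit consists of the q Sylow 2-subgroups other than C z. *)
Lemma borel_transitive z z' w x : z \in G -> #[z] = 2 -> z' \in G -> #[z'] = 2 ->
  w \in G -> #[w] = 2 -> C z <> C z' -> C w <> C z ->
  x \in G^# -> #[x] != 2 -> x \in N z -> x \in N z' ->
  exists2 g, g \in C z & C w = C z' :^ g.
Proof.
move=> Gz oz Gz' oz' Gw ow neqC neqCw G1x nox Nzx Nz'x.
have conj_cent a : a \in G -> #[a] = 2 -> C a \in C z :^: G.
  move=> Ga oa; have [h Gh ->] := invol_conj Gz oz Ga oa.
  by apply/imsetP; exists h; rewrite // subcent1J.
have sOP : C z' :^: C z \subset (C z :^: G) :\ C z.
  apply/subsetP=> _ /imsetP[g Cg ->]; have [Gg _] := setIP Cg.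
  rewrite in_setD1 subcent1J // conj_cent ?groupJ ?orderJ // andbT -subcent1J //.
  apply/eqP=> Cz'g; case: neqC.
  by rewrite -(conjsgK g (C z')) Cz'g conjGid ?groupV.
have oO : #|C z' :^: C z| = q.
  rewrite card_conjugates (_ : 'N_(C z)(C z') = 1).
    by have [_ oCz] := invol_cent1 Gz oz; rewrite indexg1.
  apply/trivgP/subsetP=> u /setIP[Czu nCu]; rewrite inE; apply: contraT => ntu.
  have C1u : u \in (C z)^# by rewrite in_setD1 ntu.
  have ou := mem_invol_cent1 Gz oz C1u.
  case/negP: (invol_notin_torus G1x nox ou).
  rewrite -(borel_setI Gz oz Gz' oz' neqC G1x nox Nzx Nz'x) inE.
  by rewrite (subsetP (cent1_sub_norm z)) // inE nCu (setIP Czu).1.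
have oP : #|(C z :^: G) :\ C z| = q.
  have := cardsD1 (C z) (C z :^: G); rewrite conj_cent // card_conjugates.
  rewrite -divgS ?subsetIl //= card_norm_invol // (card_SL2_even SL2_G).
  rewrite mulKn ?muln_gt0 ?subn_gt0 ?(ltn_trans _ q_gt2) //.
  by rewrite addn1 add1n => -[].
have /eqP EO : C z' :^: C z == (C z :^: G) :\ C z by rewrite eqEcard sOP oO oP /=.
have : C w \in C z' :^: C z by rewrite EO in_setD1 conj_cent // andbT; apply/eqP.
by case/imsetP=> g Cg ->; exists g.
Qed.

Lemma split_torus_borel x : x \in G^# -> #|C x| = (q - 1)%N ->
  exists z, [/\ z \in G, #[z] = 2 & x \in N z].
Proof.
move=> G1x oC; have [z Gz oz] := exists_invol.
have [y [G1y _ oCy defN]] := borel_complement Gz oz.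
have [g Gg Cx] := split_torus_conj G1y G1x oCy oC.
exists (z ^ g); rewrite groupJ ?orderJ // -norm_conj // mem_conjg.
split=> //; have [_ <- _ _] := sdprodP defN.
have : x ^ g^-1 \in C y by rewrite -mem_conjg -Cx mem_cent1.
by apply: subsetP; apply: mulG_subr.
Qed.

(** If x lies in N z, an involution v that inverts x moves N z to a second Borel
    subgroup over x.  A third one is the image of the second under some g in
    C z, and g normalizes the intersection C x of N z with these two; but
    C x is self-normalizing in N z, so g lies in C x and in C z, and g = 1. *)
Lemma split_torus_two_borels x : x \in G^# -> #|C x| = (q - 1)%N ->
  exists z1 z2, [/\ z1 \in G /\ #[z1] = 2, z2 \in G /\ #[z2] = 2, C z1 <> C z2,
    x \in N z1 /\ x \in N z2
  & forall w, w \in G -> #[w] = 2 -> x \in N w -> C w = C z1 \/ C w = C z2].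
Proof.
move=> G1x oC; have [z [Gz oz Nzx]] := split_torus_borel G1x oC.
have nox := torus_not_invol G1x oC (or_introl erefl).
have [cycC _ oddC oN invN] := torus_cent1 G1x nox.
have [v Nv not_Cv] : exists2 v, v \in N x & v \notin C x.
  apply/subsetPn/negP=> /subset_leq_card; rewrite oN leqNgt ltn_Pmull //.
have Gv : v \in G by case/setIP: Nv.
have [|ov inv_v] := invN v; first by rewrite inE not_Cv.
have [_ oCz] := invol_cent1 Gz oz.
have Gzv : z ^ v \in G by rewrite groupJ.
have ozv : #[z ^ v] = 2 by rewrite orderJ.
have neqC : C z <> C (z ^ v).
  move=> eqC; case/negP: not_Cv.
  apply: (subsetP (borel_setI_torus_norm Gz oz G1x nox Nzx)).
  rewrite in_setI Nv andbT inE Gv; apply/normP.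
  by rewrite subcent1J.
have Nzvx : x \in N (z ^ v).
  have xv : x ^ v^-1 = x^-1.
    by apply: (canLR (conjgK v)); rewrite conjVg inv_v ?mem_cent1 // invgK.
  by rewrite -norm_conj // mem_conjg xv groupV.
exists z, (z ^ v); split=> // w Gw ow Nwx.
have [Cw | /eqP neqCw] := eqVneq (C w) (C z); [by left | right].
have [g Cg Cw] := borel_transitive Gz oz Gzv ozv Gw ow neqC neqCw G1x nox Nzx Nzvx.
have Gg : g \in G by case/setIP: Cg.
have Nzg : g \in N z by rewrite (subsetP (cent1_sub_norm z)).
suff -> : C w = C (z ^ v) :^ 1 by rewrite conjsg1.
suff <- : g = 1 by [].
apply/eqP/contraT=> ntg; have ou : #[g] = 2.
  by apply: (mem_invol_cent1 Gz oz); rewrite in_setD1 ntg.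
case/negP: (invol_notin_torus G1x nox ou).
apply: (subsetP (borel_setI_torus_norm Gz oz G1x nox Nzx)).
rewrite in_setI Nzg inE Gg; apply/normP.
rewrite -{1}(borel_setI Gz oz Gzv ozv neqC G1x nox Nzx Nzvx).
rewrite conjIg (conjGid Nzg) norm_conj //.
have -> : N ((z ^ v) ^ g) = N w by rewrite Cw (subcent1J _ Gg).
by apply: (borel_setI Gz oz Gw ow) => // /esym.
Qed.

Lemma SL2_order_cases x : x \in G^# ->
  [\/ #[x] = 2%N, #[x] %| (q - 1)%N | #[x] %| (q + 1)%N].
Proof.
move=> G1x; have [ox | nox] := eqVneq #[x] 2; first by constructor 1.
have := order_dvdG (mem_cent1 G1x); have [_ oC _ _ _] := torus_cent1 G1x nox.
by case: oC => ->; [constructor 2 | constructor 3].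
Qed.

(** The orders q - 1 and q + 1 are coprime. *)
Lemma card_cent1_order x c : x \in G^# -> c = (q - 1)%N \/ c = (q + 1)%N ->
  #[x] %| c -> #|C x| = c.
Proof.
move=> G1x Dc dv_c; have odd_x := dvdn_odd dv_c (odd_torus_order Dc).
have nox : #[x] != 2 by apply: contraTneq odd_x => ->.
have [_ oC _ _ _] := torus_cent1 G1x nox; have dvC := order_dvdG (mem_cent1 G1x).
suff not_both : ~~ ((#[x] %| q - 1) && (#[x] %| q + 1)).
  case: oC Dc dvC dv_c => -> [] -> // dv1 dv2; first by rewrite dv1 dv2 in not_both.
  by rewrite dv1 dv2 in not_both.
apply: contraL odd_x => /andP[dv1 dv2]; have : #[x] %| 2.
  have sum_q : (2 + (q - 1) = q + 1)%N by clear -q_gt2; lia.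
  by move: dv2; rewrite -sum_q dvdn_addl.
by rewrite dvdn_divisors // !inE (negPf nox) order_eq1 (negPf (setD1P G1x).1).
Qed.

Lemma Sylow_borel_structure (P : {group gT}) : P \in 'Syl_2(G) ->
  [/\ 2.-abelem P, #|P| = q, #|'N_G(P)| = (q * (q - 1))%N
    & exists2 K : {group gT}, P ><| K = 'N_G(P) & K \isog Zp (q - 1)].
Proof.
case/Sylow_invol_cent1=> z Gz [oz ->]; have [abC oC] := invol_cent1 Gz oz.
split; rewrite ?card_norm_invol //.
have [y [G1y noy oCy defN]] := borel_complement Gz oz.
have [cycC _ _ _ _] := torus_cent1 G1y noy.
by exists 'C_G[y]%G; rewrite // -oCy; apply: cyclic_isog_Zp.
Qed.

Lemma norm_isog_cases x : x \in G^# ->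
  [\/ isog_Borel G (N x), N x \isog 'D_(2 * (q - 1)) | N x \isog 'D_(2 * (q + 1))].
Proof.
move=> G1x; have [ox | nox] := eqVneq #[x] 2.
  by constructor 1; rewrite norm_isog_Borel // ox.
have := torus_norm_dihedral G1x nox; have [_ oC _ _ _] := torus_cent1 G1x nox.
by case: oC => ->; [constructor 2 | constructor 3].
Qed.

Section PrimeExponent.

Variable p : nat.
Hypotheses (p_prime : prime p) (Dq : q = (2 ^ p)%N).

(** Otherwise dickson_order gives |H| = s (s - 1) (s + 1) with s = 2 ^ m, m > 1,
    and m divides the prime p. *)
Theorem proper_sub_norm H : H \proper G -> exists2 x, x \in G^# & H \subset N x.
Proof.
move=> prH; have [sHG _] := andP prH.
have [/exists_inP[x G1x sHN] | ] := boolP [exists x in G^#, H \subset N x].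
  by exists x.
rewrite negb_exists_in => /forall_inP nonorm.
have [s [oH s_2 s_gt3 s_dv]] := dickson_order sHG nonorm.
have [m Ds] := p_natP s_2; subst s.
have m_gt1 : 1 < m by move: s_gt3; clear; case: m => [|[]].
rewrite Dq in s_dv; have m_p := dvdn_pred_exp2 m_gt1 s_dv.
have m_p' : m = p.
  by case/primeP: p_prime => _ /(_ m m_p) /pred2P[m1|//]; rewrite m1 in m_gt1.
by move: (proper_card prH); rewrite oH m_p' (card_SL2_even SL2_G) Dq ltnn.
Qed.

Lemma maximalP (M : {group gT}) :
  reflect (exists2 x, x \in G^# & M :=: N x) (maximal M G).
Proof.
apply: (iffP idP) => [maxM | [x G1x DM]].
  have /maxgroupP[prM maxM'] := maxM; have [x G1x sMN] := proper_sub_norm prM.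
  by exists x => //; rewrite -(maxM' 'N_G(C x)%G) ?norm_proper.
rewrite (group_inj DM); exact: norm_maximal proper_sub_norm.
Qed.

Lemma maximals_overP x (M : {group gT}) :
  reflect (exists w, [/\ w \in G^#, M :=: N w & x \in N w]) (M \in maximals_over G x).
Proof.
rewrite inE; apply: (iffP andP) => [[/maximalP[w G1w DM] Mx] | [w [G1w DM Nx]]].
  by exists w; rewrite -DM.
by rewrite DM; split=> //; apply/maximalP; exists w.
Qed.

Lemma norm_maximals_over x w : w \in G^# -> x \in N w -> 'N_G(C w)%G \in maximals_over G x.
Proof. by move=> G1w Nx; apply/maximals_overP; exists w. Qed.

(** Each N w is soluble, and soluble subgroups lie in some N w. *)
Lemma solubilizer_maximals x : x \in G^# ->
  solubilizer G x = \bigcup_(M in maximals_over G x) M.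
Proof.
move=> G1x; have [ntx Gx] := setD1P G1x.
apply/setP=> y; rewrite inE; apply/andP/bigcupP=> [[Gy sol_xy] | [M]].
  have [||w G1w] := solvable_sub_norm _ sol_xy.
  - by rewrite gen_subG subUset !sub1set Gx.
  - by apply/trivgPn; exists x; rewrite // mem_gen ?set21.
  rewrite gen_subG subUset !sub1set => /andP[Nx Ny].
  by exists 'N_G(C w)%G => //; apply: norm_maximals_over.
case/maximals_overP=> w [G1w -> Nx] Ny; split; first by case/setIP: Ny.
by apply: solvableS (norm_solvable G1w); rewrite gen_subG subUset !sub1set Nx.
Qed.

Lemma maximals_over_nonsplit x : x \in G^# -> #|C x| = (q + 1)%N ->
  maximals_over G x = [set 'N_G(C x)%G].
Proof.
move=> G1x oC; have nox := torus_not_invol G1x oC (or_intror erefl).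
apply/setP=> M; rewrite in_set1; apply/maximals_overP/eqP=> [[w [G1w DM Nx]] | ->].
  apply: group_inj; rewrite DM /=; congr 'N_G(_).
  have [ow | now] := eqVneq #[w] 2.
    have [_] := torus_in_borel (setD1P G1w).2 ow G1x nox Nx.
    by rewrite oC; clear -q_gt2; lia.
  apply/esym/cent1_sub_eq; rewrite // in_setD1 (setD1P G1x).1.
  exact: torus_norm_odd.
by exists x; split; rewrite // (subsetP (cent1_sub_norm x)) ?mem_cent1.
Qed.

Lemma maximals_over_split x z1 z2 : x \in G^# -> #|C x| = (q - 1)%N ->
  z1 \in G -> #[z1] = 2 -> z2 \in G -> #[z2] = 2 -> x \in N z1 -> x \in N z2 ->
  (forall w, w \in G -> #[w] = 2 -> x \in N w -> C w = C z1 \/ C w = C z2) ->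
  maximals_over G x = [set 'N_G(C z1)%G; 'N_G(C z2)%G; 'N_G(C x)%G].
Proof.
move=> G1x oC Gz1 oz1 Gz2 oz2 Nz1 Nz2 all_z.
have nox := torus_not_invol G1x oC (or_introl erefl).
apply/setP=> M; rewrite in_setU in_set2 in_set1 -orbA.
apply/maximals_overP/or3P=> [[w [G1w DM Nx]] | ].
  have DM' : M = 'N_G(C w)%G by apply: group_inj.
  have [ow | now] := eqVneq #[w] 2.
    have [Cw | Cw] := all_z w (setD1P G1w).2 ow Nx.
      by constructor 1; rewrite DM'; apply/eqP/group_inj; rewrite /= Cw.
    by constructor 2; rewrite DM'; apply/eqP/group_inj; rewrite /= Cw.
  constructor 3; rewrite DM'; apply/eqP/group_inj; rewrite /=; congr 'N_G(_).
  apply/esym/cent1_sub_eq; rewrite // in_setD1 (setD1P G1x).1.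
  exact: torus_norm_odd.
have Nx : x \in N x by rewrite (subsetP (cent1_sub_norm x)) ?mem_cent1.
case=> /eqP->; [exists z1 | exists z2 | by exists x]; split=> //.
  exact: invol_sub1.
exact: invol_sub1.
Qed.

Lemma eq_norm_cent1 x y : x \in G^# -> y \in G^# ->
  ('N_G(C x)%G == 'N_G(C y)%G) = (C x == C y).
Proof.
move=> G1x G1y; apply/eqP/eqP=> [/(congr1 val) /= eqN | eqC].
  by apply: norm_sub_cent1_eq; rewrite // eqN.
by apply: group_inj; rewrite /= eqC.
Qed.

(** The incidences between the involutions and the tori of order c that they
    invert are counted twice.  A torus is inverted by c involutions, there are
    |G| / (2 c) tori, and (q - 1) (q + 1) involutions, all of which invert the
    same number of tori. *)
Lemma card_maximals_over_invol z y c : z \in G -> #[z] = 2 -> y \in G^# -> #|C y| = c ->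
  c = (q - 1)%N \/ c = (q + 1)%N ->
  (forall x, x \in G^# -> #|C x| = c -> exists2 g, g \in G & C x = C y :^ g) ->
  #|[set M in maximals_over G z | M \isog 'D_(2 * c)]| = (q %/ 2)%N.
Proof.
move=> Gz oz G1y oCy Dc conj_y.
have noy := torus_not_invol G1y oCy Dc.
pose tori := C y :^: G; pose inverted u := [set T in tori | u \in 'N(T)].
have toriP T : reflect (exists2 x, x \in G^# & T = C x /\ #|C x| = c) (T \in tori).
  apply: (iffP imsetP) => [[g Gg ->] | [x G1x [-> oCx]]]; last exact: conj_y.
  exists (y ^ g); first by rewrite in_setD1 conjg_eq1 groupJ ?(setD1P G1y).1 ?(setD1P G1y).2.
  by rewrite -subcent1J // cardJg oCy.
have -> : [set M in maximals_over G z | M \isog 'D_(2 * c)]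
    = [set 'N_G(T)%G | T in inverted z].
  apply/setP=> M; rewrite in_set; apply/andP/imsetP=> [[/maximals_overP[x [G1x DM Nz]]] | [T]].
    rewrite DM norm_isog_dihedral // => /eqP oCx; exists (C x); last exact: group_inj.
    by rewrite inE (setIP Nz).2 andbT; apply/toriP; exists x.
  rewrite inE => /andP[/toriP[x G1x [-> oCx]] nz] ->; split.
    by apply: norm_maximals_over; rewrite // inE Gz.
  by rewrite /= norm_isog_dihedral // oCx.
rewrite card_in_imset; last first.
  move=> T1 T2; rewrite !inE => /andP[/toriP[x G1x [-> _]] _] /andP[/toriP[w G1w [-> _]] _].
  by move/eqP; rewrite eq_norm_cent1 // => /eqP.
pose I := [set u in G | #[u] == 2].
have toriJ (T : {set gT}) g : g \in G -> T \in tori -> T :^ g \in tori.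
  move=> Gg /imsetP[h Gh ->]; apply/imsetP; exists (h * g); first by rewrite groupM.
  by rewrite conjsgM.
have inv_const u : u \in I -> #|inverted u| = #|inverted z|.
  rewrite inE => /andP[Gu /eqP ou]; have [g Gg ->] := invol_conj Gz oz Gu ou.
  rewrite -(card_imset (inverted z) (@conjsg_inj _ g)); congr #|pred_of_set _|.
  apply/setP=> T; rewrite inE; apply/andP/imsetP=> [[torT nT] | [S]].
    exists (T :^ g^-1); last by rewrite conjsgKV.
    by rewrite inE toriJ ?groupV //= normJ mem_conjgV.
  by rewrite inE => /andP[torS nS] ->; rewrite toriJ // normJ memJ_conjg.
have oI : #|I| = ((q - 1) * (q + 1))%N.
  have -> : I = z ^: G.
    apply/setP=> u; rewrite inE; apply/andP/imsetP=> [[Gu /eqP ou] | [g Gg ->]].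
      by have [g Gg ->] := invol_conj Gz oz Gu ou; exists g.
    by rewrite groupJ // orderJ oz.
  have [_ oCz] := invol_cent1 Gz oz.
  rewrite -index_cent1 -divgS ?subsetIl //= oCz (card_SL2_even SL2_G) -mulnA mulKn //.
  by rewrite (ltn_trans _ q_gt2).
have inv_c (T : {set gT}) : T \in tori -> #|[set u in I | u \in 'N(T)]| = c.
  case/toriP=> x G1x [-> oCx]; have nox := torus_not_invol G1x oCx Dc.
  have [_ _ _ oN invN] := torus_cent1 G1x nox.
  have -> : [set u in I | u \in 'N(C x)] = N x :\: C x.
    apply/setP=> u; apply/idP/idP=> [|NCu].
      rewrite inE => /andP[]; rewrite inE => /andP[Gu /eqP ou] nu.
      by rewrite in_setD invol_notin_torus // in_setI Gu.
    have [ou _] := invN u NCu; have /setDP[/setIP[Gu nu] _] := NCu.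
    by rewrite in_set nu andbT in_set Gu ou.
  by rewrite cardsD (setIidPr (cent1_sub_norm x)) oN oCx mul2n -addnn addnK.
have := double_count tori I (fun (T : {set gT}) (u : gT) => u \in 'N(T)).
rewrite (eq_bigr _ inv_c) (eq_bigr _ inv_const) !sum_nat_const oI.
have : (#|tori| * (2 * c) = q * (q - 1) * (q + 1))%N.
  rewrite card_conjugates -oCy -(card_SL2_even SL2_G).
  by have [_ _ _ <- _] := torus_cent1 G1y noy; rewrite mulnC Lagrange ?subsetIl.
move: #|tori| #|inverted z| => t a e1 e2.
have q2_gt0 : 0 < (q - 1) * (q + 1).
  by rewrite muln_gt0 subn_gt0 addn1 andbT (ltn_trans _ q_gt2).
suff : (2 * a)%N = q by move=> <-; rewrite mulKn.
apply/eqP; rewrite -(eqn_pmul2l q2_gt0); apply/eqP.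
by rewrite mulnCA -e2 mulnCA e1 -mulnA mulnC.
Qed.

(** At least one of the two subgroups is the normalizer of a torus.  The torus
    meets the other subgroup trivially: for the normalizer of another torus
    because tori are disjoint, and for a Borel subgroup because it contains z,
    which inverts the torus.  So the intersection has order at most 2. *)
Lemma invol_maximals_setI z (M1 M2 : {group gT}) : z \in G -> #[z] = 2 ->
  M1 \in maximals_over G z -> M2 \in maximals_over G z -> M1 != M2 ->
  #|M1 :&: M2| = 2.
Proof.
move=> Gz oz.
have torus_case x w : x \in G^# -> w \in G^# -> z \in N x -> z \in N w -> #[x] != 2 ->
    C x <> C w -> #|N x :&: N w| = 2.
  move=> G1x G1w Nxz Nwz nox neqC; have [_ _ oddC oN _] := torus_cent1 G1x nox.
  have tiC : C x :&: (N x :&: N w) = 1.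
    apply/trivgP/subsetP=> y /setIP[Cy /setIP[Ny Nwy]]; rewrite inE; apply: contraT => nty.
    have C1y : y \in (C x)^# by rewrite in_setD1 nty.
    have eqC := cent1_sub_eq G1x C1y.
    have G1y : y \in G^# by rewrite in_setD1 nty; case/setIP: Cy.
    have noy : #[y] != 2 by apply: contraTneq Cy => /(invol_notin_torus G1x nox).
    have [ow | now] := eqVneq #[w] 2.
      have := borel_setI_torus_norm (setD1P G1w).2 ow G1y noy Nwy.
      rewrite eqC => /subsetP/(_ z); rewrite inE Nwz Nxz => /(_ isT).
      by rewrite (negPf (invol_notin_torus G1x nox oz)).
    case: neqC; rewrite -eqC; apply: cent1_sub_eq => //.
    by rewrite in_setD1 nty torus_norm_odd.
  apply/eqP; rewrite eqn_leq; apply/andP; split.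
    rewrite -(leq_pmul2l (cardG_gt0 (C x))) -(TI_cardMg tiC) mulnC -oN.
    by rewrite subset_leq_card // mul_subG ?subsetIl ?cent1_sub_norm.
  by rewrite -oz dvdn_leq ?cardG_gt0 ?order_dvdG // inE Nxz.
case/maximals_overP=> x [G1x DM1 Nx] /maximals_overP[w [G1w DM2 Nw]] neqM.
have neqC : C x <> C w.
  by move=> eqC; case/eqP: neqM; apply: group_inj; rewrite DM1 DM2 eqC.
rewrite DM1 DM2; have [ox | nox] := eqVneq #[x] 2; last exact: torus_case.
rewrite setIC; apply: torus_case => //; last by move/esym.
apply/eqP=> ow; have ntz : z != 1 by rewrite -order_gt1 oz.
have [Gx Gw] := ((setD1P G1x).2, (setD1P G1w).2).
case: neqC; apply: etrans (esym _) _.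
  by apply: (@cent1_sub_eq x z); rewrite // in_setD1 ntz invol_norm_invol.
by apply: cent1_sub_eq; rewrite // in_setD1 ntz invol_norm_invol.
Qed.

(** Outside the group generated by z the maximal subgroups over z are disjoint. *)
Theorem invol_solubilizer z : z \in G -> #[z] = 2 ->
  [/\ #|[set M in maximals_over G z | isog_Borel G M]| = 1%N,
      #|[set M in maximals_over G z | M \isog 'D_(2 * (q - 1))]| = (q %/ 2)%N,
      #|[set M in maximals_over G z | M \isog 'D_(2 * (q + 1))]| = (q %/ 2)%N,
      forall M1 M2 : {group gT}, M1 \in maximals_over G z -> M2 \in maximals_over G z ->
        M1 != M2 -> M1 :&: M2 \isog Zp 2
    & #|solubilizer G z| = (3 * q * (q - 1))%N].
Proof.
move=> Gz oz; have G1z := invol_sub1 Gz oz.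
have [y G1y oCy] := exists_split_torus; have [w G1w oCw] := exists_nonsplit_torus.
have Bz : [set M in maximals_over G z | isog_Borel G M] = [set 'N_G(C z)%G].
  apply/setP=> M; rewrite in_set1 in_set; apply/andP/eqP=> [[/maximals_overP[x [G1x DM Nz]]] | ->].
    rewrite DM norm_isog_Borel // => /eqP ox; apply: group_inj; rewrite DM /=; congr 'N_G(_).
    apply/esym/cent1_sub_eq; rewrite // in_setD1 (setD1P G1z).1 /=.
    exact: invol_norm_invol (setD1P G1x).2 ox Nz oz.
  rewrite /= norm_isog_Borel // oz; split=> //.
  by apply: norm_maximals_over; rewrite // (subsetP (cent1_sub_norm z)) ?mem_cent1.
have D1 := card_maximals_over_invol Gz oz G1y oCy (or_introl erefl)
  (fun x G1x oCx => split_torus_conj G1y G1x oCy oCx).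
have D2 := card_maximals_over_invol Gz oz G1w oCw (or_intror erefl)
  (fun x G1x oCx => nonsplit_torus_conj G1w G1x oCw oCx).
have oB : #|[set M in maximals_over G z | isog_Borel G M]| = 1%N by rewrite Bz cards1.
split=> // [M1 M2 Mz1 Mz2 neqM | ].
  have o2 := invol_maximals_setI Gz oz Mz1 Mz2 neqM.
  by rewrite -o2; apply/cyclic_isog_Zp/prime_cyclic; rewrite o2.
rewrite (solubilizer_maximals G1z).
pose F (M : {group gT}) := M :\: <[z]>.
have szM (M : {group gT}) : M \in maximals_over G z -> <[z]> \subset M.
  by rewrite inE cycle_subG => /andP[].
have oF (M : {group gT}) : M \in maximals_over G z -> #|F M| = (#|M| - 2)%N.
  by move=> Mz; rewrite cardsD (setIidPr (szM M Mz)) -orderE oz.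
have -> : \bigcup_(M in maximals_over G z) M
    = <[z]> :|: \bigcup_(M in maximals_over G z) F M.
  apply/setP=> u; rewrite in_setU; apply/bigcupP/orP=> [[M Mz Mu] | [zu | /bigcupP[M Mz]]].
  - have [zu | not_zu] := boolP (u \in <[z]>); [by left | right].
    by apply/bigcupP; exists M; rewrite // in_setD not_zu.
  - exists 'N_G(C z)%G.
      by apply: norm_maximals_over; rewrite // (subsetP (cent1_sub_norm z)) ?mem_cent1.
    apply: subsetP zu; rewrite cycle_subG.
    by rewrite (subsetP (cent1_sub_norm z)) ?mem_cent1.
  - by case/setDP=> Mu _; exists M.
have disF : {in maximals_over G z &, forall M1 M2 : {group gT}, M1 != M2 -> [disjoint F M1 & F M2]}.
  move=> M1 M2 Mz1 Mz2 neqM; have o2 := invol_maximals_setI Gz oz Mz1 Mz2 neqM.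
  have /eqP eqI : <[z]> == M1 :&: M2 :> {set gT}.
    by rewrite eqEcard subsetI !szM //= o2 -orderE oz.
  apply/pred0P=> u; apply/negP=> /andP[/setDP[M1u /negP nzu] /setDP[M2u _]].
  by case: nzu; rewrite eqI inE M1u.
have -> : #|<[z]> :|: \bigcup_(M in maximals_over G z) F M|
    = (2 + \sum_(M in maximals_over G z) (#|M| - 2))%N.
  have /eqP-> : #|<[z]> :|: \bigcup_(M in maximals_over G z) F M|
    == (#|<[z]>| + #|\bigcup_(M in maximals_over G z) F M|)%N.
    rewrite (leq_card_setU _ _).2; apply: bigcup_disjoint => M _.
    by apply/pred0P=> u; apply/negP=> /andP[zu /setDP[_ /negP[]]].
  by rewrite -orderE oz (card_bigcup_disjoint disF) (eq_bigr _ oF).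
have oM (M : {group gT}) : M \in maximals_over G z ->
  (#|M| - 2 = (q * (q - 1) - 2) * isog_Borel G M + (2 * (q - 1) - 2) * (M \isog 'D_(2 * (q - 1)))
    + (2 * (q + 1) - 2) * (M \isog 'D_(2 * (q + 1))))%N.
  case/maximals_overP=> x [G1x DM _]; rewrite DM norm_isog_Borel //.
  rewrite (norm_isog_dihedral G1x (or_introl erefl)) (norm_isog_dihedral G1x (or_intror erefl)).
  have neq1 : (q == q - 1)%N = false by clear -q_gt3; lia.
  have neq2 : (q == q + 1)%N = false by clear -q_gt3; lia.
  have neq3 : (q - 1 == q + 1)%N = false by clear -q_gt3; lia.
  have neq4 : (q + 1 == q - 1)%N = false by clear -q_gt3; lia.
  have [ox | nox] := eqVneq #[x] 2.
    have [_ ->] := invol_cent1 (setD1P G1x).2 ox.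
    by rewrite card_norm_invol ?(setD1P G1x).2 // neq1 neq2 !muln0 !addn0 muln1.
  have [_ oC _ -> _] := torus_cent1 G1x nox.
  by case: oC => ->; rewrite ?neq3 ?neq4 eqxx !muln0 !muln1 ?add0n ?addn0.
have count (P : pred {group gT}) : (\sum_(M in maximals_over G z) P M
    = #|[set M in maximals_over G z | P M]|)%N.
  rewrite -sum1dep_card [RHS]big_mkcondr; apply: eq_bigr => M _.
  by case: (P M).
rewrite (eq_bigr _ oM) !big_split /= -!big_distrr /= !count oB D1 D2.
exact: invol_solubilizer_arith.
Qed.

Theorem split_solubilizer x : x \in G^# -> #|C x| = (q - 1)%N ->
  [/\ #|[set M in maximals_over G x | isog_Borel G M]| = 2%N,
      #|[set M in maximals_over G x | M \isog 'D_(2 * (q - 1))]| = 1%N,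
      #|[set M in maximals_over G x | M \isog 'D_(2 * (q + 1))]| = 0%N,
      forall M1 M2 : {group gT}, M1 \in maximals_over G x -> M2 \in maximals_over G x ->
        M1 != M2 -> M1 :&: M2 \isog Zp (q - 1)
    & #|solubilizer G x| = (2 * q * (q - 1))%N].
Proof.
move=> G1x oC; have nox := torus_not_invol G1x oC (or_introl erefl).
have [z1 [z2 [[Gz1 oz1] [Gz2 oz2] neqC [Nz1 Nz2] all_z]]] := split_torus_two_borels G1x oC.
have DMx := maximals_over_split G1x oC Gz1 oz1 Gz2 oz2 Nz1 Nz2 all_z.
have [G1z1 G1z2] := (invol_sub1 Gz1 oz1, invol_sub1 Gz2 oz2).
have [_ oCz1] := invol_cent1 Gz1 oz1; have [_ oCz2] := invol_cent1 Gz2 oz2.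
have [cycC _ _ oN _] := torus_cent1 G1x nox.
have neq1 : (q == q - 1)%N = false by clear -q_gt3; lia.
have neq2 : (q == q + 1)%N = false by clear -q_gt3; lia.
have neq3 : (q - 1 == q + 1)%N = false by clear -q_gt3; lia.
have I12 : N z1 :&: N z2 = C x by apply: borel_setI.
have Iz z : z \in G -> #[z] = 2 -> x \in N z -> N z :&: N x = C x.
  move=> Gz oz Nz; apply/eqP; rewrite eqEsubset borel_setI_torus_norm //=.
  by rewrite subsetI cent1_sub_norm (torus_in_borel Gz oz G1x nox Nz).1.
have [I1 I2] := (Iz z1 Gz1 oz1 Nz1, Iz z2 Gz2 oz2 Nz2).
have memMx M : (M \in maximals_over G x)
    = [|| M == 'N_G(C z1)%G, M == 'N_G(C z2)%G | M == 'N_G(C x)%G].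
  by rewrite DMx !in_setU !in_set1 -orbA.
have isoB w : w \in G^# -> isog_Borel G 'N_G(C w)%G = (#[w] == 2) := @norm_isog_Borel w.
have isoD w : w \in G^# -> ('N_G(C w)%G \isog 'D_(2 * (q - 1))) = (#|C w| == q - 1)%N.
  by move=> G1w; apply: norm_isog_dihedral => //; left.
have isoD' w : w \in G^# -> ('N_G(C w)%G \isog 'D_(2 * (q + 1))) = (#|C w| == q + 1)%N.
  by move=> G1w; apply: norm_isog_dihedral => //; right.
split.
- have -> : [set M in maximals_over G x | isog_Borel G M] = [set 'N_G(C z1)%G; 'N_G(C z2)%G].
    apply/setP=> M; rewrite in_set memMx in_set2; apply/andP/orP=> [[] | ].
      case/or3P=> /eqP-> isoM; [by left | by right |].
      by rewrite isoB // (negPf nox) in isoM.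
    by case=> /eqP->; rewrite isoB // ?oz1 ?oz2 !eqxx ?orbT.
  rewrite cards2 eq_norm_cent1 //; by have /eqP-> := neqC.
- have -> : [set M in maximals_over G x | M \isog 'D_(2 * (q - 1))] = [set 'N_G(C x)%G].
    apply/setP=> M; rewrite in_set memMx in_set1; apply/andP/eqP=> [[] | ->].
      case/or3P=> /eqP-> isoM //.
        by rewrite isoD // oCz1 neq1 in isoM.
      by rewrite isoD // oCz2 neq1 in isoM.
    by rewrite isoD // oC !eqxx !orbT.
  by rewrite cards1.
- apply/eqP; rewrite cards_eq0; apply/eqP/setP=> M; rewrite in_set memMx in_set0.
  apply/negP=> /andP[] /or3P[] /eqP->; rewrite isoD' // ?oCz1 ?oCz2 ?oC.
  + by rewrite neq2.
  + by rewrite neq2.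
  + by rewrite neq3.
- have isoC : C x \isog Zp (q - 1) by rewrite -oC; apply: cyclic_isog_Zp.
  move=> M1 M2; rewrite !memMx.
  by do 2![case/or3P=> /eqP->]; rewrite ?eqxx //= => _; rewrite ?I12 ?I1 ?I2 // setIC ?I12 ?I1 ?I2.
rewrite solubilizer_maximals // DMx !bigcup_setU !big_set1 /=.
rewrite cardsU setIUl I1 I2 setUid cardsU I12 oN oC.
rewrite (card_norm_invol Gz1 oz1) (card_norm_invol Gz2 oz2).
have : q - 1 <= q * (q - 1) by rewrite leq_pmull // (ltn_trans _ q_gt2).
by rewrite -[(2 * q * _)%N]mulnA; clear; move: (q * (q - 1))%N (q - 1)%N => a b; lia.
Qed.

Theorem nonsplit_solubilizer x : x \in G^# -> #|C x| = (q + 1)%N ->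
  [/\ #|[set M in maximals_over G x | isog_Borel G M]| = 0%N,
      #|[set M in maximals_over G x | M \isog 'D_(2 * (q - 1))]| = 0%N,
      #|[set M in maximals_over G x | M \isog 'D_(2 * (q + 1))]| = 1%N
    & #|solubilizer G x| = (2 * (q + 1))%N].
Proof.
move=> G1x oC; have nox := torus_not_invol G1x oC (or_intror erefl).
have [_ _ _ oN _] := torus_cent1 G1x nox.
have neq : (q + 1 == q - 1)%N = false by clear -q_gt3; lia.
have filter1 (P : pred {group gT}) :
    #|[set M in maximals_over G x | P M]| = P 'N_G(C x)%G.
  rewrite maximals_over_nonsplit //; case PN: (P _).
    have -> : [set M in [set 'N_G(C x)%G] | P M] = [set 'N_G(C x)%G].
      by apply/setP=> M; rewrite !inE andbC andb_idl // => /eqP->.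
    by rewrite cards1.
  apply/eqP; rewrite cards_eq0; apply/eqP/setP=> M; rewrite !inE.
  by case: eqP => // ->.
rewrite !filter1 /= norm_isog_Borel // (negPf nox).
rewrite (norm_isog_dihedral G1x (or_introl erefl)) (norm_isog_dihedral G1x (or_intror erefl)).
rewrite oC eqxx neq; split=> //.
by rewrite solubilizer_maximals // maximals_over_nonsplit // big_set1 /= oN oC.
Qed.

End PrimeExponent.

End SL2Even.

(** * PSL(2, q) *)

Lemma SL2_even_injm (aT rT : finGroupType) (A : {group aT}) (f : {morphism A >-> rT})
    (G : {group aT}) q :
  'injm f -> G \subset A -> SL2_even G q -> SL2_even (f @* G)%G q.
Proof.
move=> injf sGA [oG conjG centG]; have inA := subsetP sGA.
split=> [| u v | x].
- by rewrite card_injm.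
- case/morphimP=> a Aa Ga -> /morphimP[b Ab Gb ->]; rewrite !order_injm // => oa ob.
  have /imsetP[g Gg ->] := conjG a b Ga Gb oa ob.
  by rewrite morphJ ?inA // memJ_class ?mem_morphim ?inA.
case/setD1P=> ntx /morphimP[a Aa Ga Dx].
have G1a : a \in G^#.
  by rewrite in_setD1 Ga andbT; apply: contraNneq ntx => a1; rewrite Dx a1 morph1.
have DC : 'C_(f @* G)[x] = f @* 'C_G[a] by rewrite Dx injm_subcent1.
have sCA : 'C_G[a] \subset A := subset_trans (subsetIl _ _) sGA.
case: (centG a G1a) => [[abC oC] | [cycC oC [u Gu au] fusion]]; [left | right].
  by rewrite DC card_injm ?injm_abelem.
rewrite DC card_injm // injm_cyclic //; split=> //.
  by exists (f u); rewrite ?mem_morphim ?inA // Dx -morphJ ?inA // au morphV.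
move=> _ /morphimP[g Ag Gg ->]; rewrite Dx -morphJ //.
have Gag : a ^ g \in G by rewrite groupJ.
case/morphimP=> b Ab Cb eq_f.
have eq_b : a ^ g = b by apply: (injmP injf) eq_f => //; apply: inA.
rewrite -eq_b in Cb; have [-> | ->] := fusion g Gg Cb; first by left.
by right; rewrite morphV.
Qed.

Lemma SL2_even_SL (F : finFieldType) : 2 \in [pchar F]%R -> SL2_even (SL_group 2 F) #|F|.
Proof.
move=> char2; split=> [| u v Gu Gv ou ov | x].
- by rewrite card_SL2 // subn1 addn1.
- exact: SL_invol_conj.
case/setD1P=> ntx Gx; have [t0 | nz_t] := eqVneq (\tr (GLval x : 'M[F]_2))%R 0%R.
  by left; apply: cent_SL_unipotent.
right; split; first exact: cent_SL_cyclic.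
- exact: card_cent_SL_torus.
- exact: cent_SL_real.
- by move=> g Gg; apply: cent_SL_fusion.
Qed.

(** The centre of SL(2, F) is trivial, so the quotient map is injective. *)
Lemma SL2_even_PSL (F : finFieldType) : 2 \in [pchar F]%R -> SL2_even (PSL_group 2 F) #|F|.
Proof.
move=> char2; have Z1 : 'Z(SL 2 F) = 1 := center_SL2_eq1 char2.
have nZ : SL_group 2 F \subset 'N('Z(SL 2 F)) := normal_norm (center_normal (SL_group 2 F)).
have inj : 'injm (coset 'Z(SL 2 F)) by rewrite ker_coset; apply/trivgP; apply: Z1.
have := SL2_even_injm inj nZ (SL2_even_SL char2).
by congr (SL2_even _ _); apply: group_inj.
Qed.

Theorem theorem3p1 (p : nat) (F : finFieldType) (p_prime : prime p)
    (cardF : #|F| = (2 ^ p)%N)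
    (x : coset_of 'Z(SL 2 F)) (Gx : x \in PSL 2 F) (x_neq1 : x != 1) :
  let q := (2 ^ p)%N in
  let G := PSL 2 F in
  let Mx := maximals_over G x in
  [/\ [\/ #[x] = 2%N, #[x] %| (q - 1)%N | #[x] %| (q + 1)%N],
      (* the group written C_2^p : C_(q-1) is the normaliser of a Sylow
         2-subgroup and has this structure *)
      forall P : {group coset_of 'Z(SL 2 F)}, P \in 'Syl_2(G) ->
        [/\ 2.-abelem P, #|P| = (2 ^ p)%N, #|'N_G(P)| = (q * (q - 1))%N
          & exists2 C : {group coset_of 'Z(SL 2 F)},
              P ><| C = 'N_G(P) & C \isog Zp (q - 1)],
      forall M : {group coset_of 'Z(SL 2 F)}, maximal M G ->
        [\/ isog_Borel G M,
            M \isog 'D_(2 * (q - 1)) | M \isog 'D_(2 * (q + 1))],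
      solubilizer G x = \bigcup_(M in Mx) M
    & [/\ (#[x] = 2%N ->
           [/\ #|[set M in Mx | isog_Borel G M]| = 1%N,
               #|[set M in Mx | M \isog 'D_(2 * (q - 1))]| = (q %/ 2)%N,
               #|[set M in Mx | M \isog 'D_(2 * (q + 1))]| = (q %/ 2)%N,
               forall M N : {group coset_of 'Z(SL 2 F)},
                 M \in Mx -> N \in Mx -> M != N -> M :&: N \isog Zp 2
             & #|solubilizer G x| = (3 * q * (q - 1))%N]),
          (#[x] %| (q - 1)%N ->
           [/\ #|[set M in Mx | isog_Borel G M]| = 2%N,
               #|[set M in Mx | M \isog 'D_(2 * (q - 1))]| = 1%N,
               #|[set M in Mx | M \isog 'D_(2 * (q + 1))]| = 0%N,
               forall M N : {group coset_of 'Z(SL 2 F)},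
                 M \in Mx -> N \in Mx -> M != N -> M :&: N \isog Zp (q - 1)
             & #|solubilizer G x| = (2 * q * (q - 1))%N])
        & (#[x] %| (q + 1)%N ->
           [/\ #|[set M in Mx | isog_Borel G M]| = 0%N,
               #|[set M in Mx | M \isog 'D_(2 * (q - 1))]| = 0%N,
               #|[set M in Mx | M \isog 'D_(2 * (q + 1))]| = 1%N
             & #|solubilizer G x| = (2 * (q + 1))%N])]].

Proof.
move=> q G Mx.
have char2 : 2 \in [pchar F]%R := card_finPcharP cardF (isT : prime 2).
have SL2_G : SL2_even (PSL_group 2 F) q by rewrite /q -cardF; apply: SL2_even_PSL.
have q_gt2 : 2 < q by rewrite /q (ltn_exp2l 1) ?prime_gt1.
have q_2 : 2.-nat q by rewrite /q pnatX.
have G1x : x \in G^# by rewrite in_setD1 x_neq1.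
have SL2_order_cases := SL2_order_cases SL2_G q_gt2 q_2.
have oC2 := card_cent1_order SL2_G q_gt2 q_2 G1x.
split.
- exact: SL2_order_cases.
- exact: Sylow_borel_structure.
- move=> M /(maximalP SL2_G q_gt2 q_2 p_prime erefl)[w G1w ->].
  exact: norm_isog_cases.
- exact: solubilizer_maximals p_prime erefl _ _.
split.
- by move=> ox; apply: invol_solubilizer ox => //; case/setD1P: G1x.
- by move=> /oC2 oC; apply: split_solubilizer (p_prime) erefl _ _ (oC _) => //; left.
- by move=> /oC2 oC; apply: nonsplit_solubilizer (p_prime) erefl _ _ (oC _) => //; right.
Qed.
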